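(* Let $B>0$ and let $\phi\in L^2(\mathbb{R})$ be such that $\mathcal{A}\phi(0,\omega)\neq 0$ for almost every $\omega\in(-2B,2B)$. Then for all $f,g\in\mathrm{PW}^2_B$ that are real-valued on the real line, the following are equivalent: (1) $f=\pm g$; (2) $|\mathcal{V}_\phi f(x,\omega)|=|\mathcal{V}_\phi g(x,\omega)|$ for all $x,\omega\in\mathbb{R}$.
   Context: For $B>0$, the Paley--Wiener space is $\mathrm{PW}^2_B:=\{f:\mathbb{C}\to\mathbb{C} \mid \exists F\in L^2([-B,B])\ \forall z\in\mathbb{C}: f(z)=\int_{-B}^B F(\xi)e^{2\pi i \xi z}\,d\xi\}$; its elements are identified with their restrictions to $\mathbb{R}$ (which lie in $L^2(\mathbb{R})$) when transforms are applied. For $f,\phi\in L^2(\mathbb{R})$ the short-time Fourier transform is $\mathcal{V}_\phi f(x,\omega)=\int_{\mathbb{R}} f(t)\overline{\phi(t-x)}e^{-2\pi i t\omega}\,dt$, and the ambiguity function of $f\in L^2(\mathbb{R})$ is $\mathcal{A}f(x,\omega):=e^{\pi i x\omega}\mathcal{V}_f f(x,\omega)$, for $x,\omega\in\mathbb{R}$. *)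

(* Defs.v *)
From mathcomp Require Import all_boot all_algebra.
From mathcomp Require Import all_classical all_reals all_analysis.
From mathcomp Require Import complex.
Set Implicit Arguments.
Unset Strict Implicit.
Unset Printing Implicit Defensive.
Import GRing.Theory Num.Theory.
Local Open Scope classical_set_scope.
Local Open Scope ring_scope.

Definition cexp (R : realType) (w : R[i]) : R[i] :=
  Complex (expR (complex.Re w) * cos (complex.Im w))
          (expR (complex.Re w) * sin (complex.Im w)).

Definition cint (R : realType) (D : set R) (f : R -> R[i]) : R[i] :=
  Complex (Rintegral (@lebesgue_measure R) D (fun x => complex.Re (f x)))
          (Rintegral (@lebesgue_measure R) D (fun x => complex.Im (f x))).

Definition L2on (R : realType) (D : set R) (f : R -> R[i]) : Prop :=
  measurable_fun D (fun x => complex.Re (f x)) /\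
  measurable_fun D (fun x => complex.Im (f x)) /\
  (@lebesgue_measure R).-integrable D (fun x => ((ComplexField.Normc.normc (f x)) ^+ 2)%:E).

Definition L2 (R : realType) (f : R -> R[i]) : Prop := L2on setT f.

Definition PW2 (R : realType) (B : R) (f : R[i] -> R[i]) : Prop :=
  exists F : R -> R[i], L2on `[- B, B] F /\
    forall z : R[i],
      f z = cint `[- B, B]
              (fun xi => F xi * cexp (Complex 0 (2 * pi * xi) * z)).

Definition restrR (R : realType) (f : R[i] -> R[i]) : R -> R[i] :=
  fun t => f (Complex t 0).

Definition STFT (R : realType) (phi f : R -> R[i]) (x w : R) : R[i] :=
  cint setT (fun t => f t * conjc (phi (t - x)) * cexp (Complex 0 (- (2 * pi * t * w)))).

Definition ambig (R : realType) (f : R -> R[i]) (x w : R) : R[i] :=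
  cexp (Complex 0 (pi * x * w)) * STFT f f x w.

(* Main.v *)
Require Import Defs.
From mathcomp Require Import all_boot all_algebra.
From mathcomp Require Import all_classical all_reals all_analysis.
From mathcomp Require Import complex.
From mathcomp Require Import all_order measurable_realfun ring lra.
Import Order.TTheory GRing.Theory Num.Theory.
Import numFieldNormedType.Exports.
Local Open Scope classical_set_scope.
Local Open Scope ring_scope.
Set Implicit Arguments.
Unset Strict Implicit.
Unset Printing Implicit Defensive.

(** For fixed x, the map w |-> V_phi f (x, w) is the Fourier transform of
    f * conj (phi (. - x)), so by Plancherel equal spectrogram magnitudes force
    the integrals of (|f|^2 - |g|^2) |phi (. - x)|^2 to vanish for every x. As f and g
    are real on the real line, |f|^2 - |g|^2 = f^2 - g^2 is the Fourier transform of
    H = F * F - G * G (convolutions), which is supported in [-2B, 2B]. The vanishing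
    integrals then say that H times the Fourier transform of |phi|^2 has a null Fourier
    transform. As the transform of |phi|^2 is A phi (0, .) up to reflection, H = 0 a.e.
    and f^2 = g^2 on the real line. Finally f - g and f + g are real-analytic with zero
    product, so one of them vanishes, and F = G or F = - G a.e. by Fourier uniqueness.

    Uniqueness comes from Abel summation against exp (- 2 pi e |x|), whose transform, the
    Poisson kernel, has the explicit primitive atan. Plancherel reduces to uniqueness:
    |ft u|^2 is the Fourier transform of the autocorrelation of u, and |u|_2^2 is the
    limit of the averages of the autocorrelation over [-d, d] as d tends to 0. *)

(** Plancherel would follow from comparing autocorrelations at 0, but uniqueness as proved here
    compares them only through integrals over intervals. Averages over [[- d, d]] therefore replace
    the value at 0: Fatou bounds the averages of one autocorrelation from below in the limit, the
    parallelogram inequality bounds the other from above, and the two bounds meet. No inversion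
    formula is involved: [ft_mult], an instance of Fubini, moves the transform onto explicit
    functions. Plancherel is stated for functions that are both integrable and square integrable,
    whereas [phi] is only square integrable. The windowed product qualifies since its band-limited
    factor is bounded, which yields square integrability, and is itself square integrable, which
    yields integrability. The latter fact is [L2_ft]. Bounds through [normc_cint_le] lose a factor
    2. This is harmless where only finiteness or decay counts, while [Re_autocorr_le], which has to
    be sharp, avoids it. *)

Local Notation Re := complex.Re.
Local Notation Im := complex.Im.
Local Notation normc := ComplexField.Normc.normc.

(** * Complex-valued functions *)

Section complex_numbers.
Variable R : realType.
Implicit Types x y z : R[i].

Lemma complex_ext x y : Re x = Re y -> Im x = Im y -> x = y.
Proof. by case: x; case: y => a b c d /= -> ->. Qed.

Lemma ReM x y : Re (x * y) = Re x * Re y - Im x * Im y.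
Proof. by case: x; case: y. Qed.

Lemma ImM x y : Im (x * y) = Re x * Im y + Im x * Re y.
Proof. by case: x; case: y. Qed.

Lemma ReD x y : Re (x + y) = Re x + Re y. Proof. by case: x; case: y. Qed.
Lemma ImD x y : Im (x + y) = Im x + Im y. Proof. by case: x; case: y. Qed.
Lemma ReN x : Re (- x) = - Re x. Proof. by case: x. Qed.
Lemma ImN x : Im (- x) = - Im x. Proof. by case: x. Qed.
Lemma ReJ x : Re (conjc x) = Re x. Proof. by case: x. Qed.
Lemma ImJ x : Im (conjc x) = - Im x. Proof. by case: x. Qed.

Definition ReImE := (ReM, ImM, ReD, ImD, ReN, ImN, ReJ, ImJ).

Lemma sqr_normcE x : normc x ^+ 2 = Re x ^+ 2 + Im x ^+ 2.
Proof. by case: x => a b /=; rewrite sqr_sqrtr// addr_ge0// sqr_ge0. Qed.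

Lemma normc_ge0 x : 0 <= normc x. Proof. by case: x => a b; exact: sqrtr_ge0. Qed.

Lemma normRe_le x : `|Re x| <= normc x.
Proof. by case: x => a b /=; rewrite -sqrtr_sqr ler_wsqrtr// lerDl sqr_ge0. Qed.

Lemma normIm_le x : `|Im x| <= normc x.
Proof. by case: x => a b /=; rewrite -sqrtr_sqr ler_wsqrtr// lerDr sqr_ge0. Qed.

Lemma normc_le x : normc x <= `|Re x| + `|Im x|.
Proof.
rewrite -(@ler_pXn2r _ 2) ?nnegrE ?normc_ge0 ?addr_ge0//.
by rewrite sqr_normcE sqrrD !real_normK ?num_real// addrAC lerDl mulrn_wge0 ?mulr_ge0.
Qed.

Lemma normc_conjc x : normc (conjc x) = normc x.
Proof. by case: x => a b /=; rewrite sqrrN. Qed.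

Lemma normcD x y : normc (x + y) <= normc x + normc y.
Proof. exact: le_normcD. Qed.

Lemma normcR (a : R) : normc a%:C%C = `|a|.
Proof. by rewrite /= expr0n addr0 sqrtr_sqr. Qed.

Lemma mulcJ x : x * conjc x = (normc x ^+ 2)%:C%C.
Proof. by apply: complex_ext; rewrite sqr_normcE; case: x => a b /=; ring. Qed.

Lemma conjcM x y : conjc (x * y) = conjc x * conjc y.
Proof. by apply: complex_ext; rewrite !ReImE; ring. Qed.

Definition cis (a : R) : R[i] := cexp (Complex 0 (2 * pi * a)).

Lemma cisE a : cis a = Complex (cos (2 * pi * a)) (sin (2 * pi * a)).
Proof. by rewrite /cis /cexp /= expR0 !mul1r. Qed.

Lemma cisD a b : cis (a + b) = cis a * cis b.
Proof.
by apply: complex_ext; rewrite !ReImE !cisE/= mulrDr ?cosD ?sinD// addrC.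
Qed.

Lemma cis0 : cis 0 = 1.
Proof. by rewrite cisE mulr0 cos0 sin0. Qed.

Lemma cisN a : cis (- a) = conjc (cis a).
Proof. by rewrite !cisE mulrN cosN sinN. Qed.

Lemma normc_cis a : normc (cis a) = 1.
Proof. by rewrite cisE /= cos2Dsin2 sqrtr1. Qed.

End complex_numbers.

Section measurable_complex.
Context (R : realType) d (T : measurableType d).
Implicit Types f g : T -> R[i].

Definition cmf f := measurable_fun setT (fun x => Re (f x)) /\
  measurable_fun setT (fun x => Im (f x)).

Lemma cmfD f g : cmf f -> cmf g -> cmf (fun x => f x + g x).
Proof.
move=> [f1 f2] [g1 g2]; split.
  by under eq_fun do rewrite ReD; exact: measurable_funD.
by under eq_fun do rewrite ImD; exact: measurable_funD.
Qed.

Lemma cmfN f : cmf f -> cmf (fun x => - f x).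
Proof.
move=> [f1 f2]; split.
  by under eq_fun do rewrite ReN; exact: measurableT_comp.
by under eq_fun do rewrite ImN; exact: measurableT_comp.
Qed.

Lemma cmfM f g : cmf f -> cmf g -> cmf (fun x => f x * g x).
Proof.
move=> [f1 f2] [g1 g2]; split.
  by under eq_fun do rewrite ReM; apply: measurable_funB; exact: measurable_funM.
by under eq_fun do rewrite ImM; apply: measurable_funD; exact: measurable_funM.
Qed.

Lemma cmfJ f : cmf f -> cmf (fun x => conjc (f x)).
Proof.
move=> [f1 f2]; split.
  by under eq_fun do rewrite ReJ.
by under eq_fun do rewrite ImJ; exact: measurableT_comp.
Qed.

Lemma cmf_cst (c : R[i]) : cmf (fun=> c).
Proof. by split; exact: measurable_cst. Qed.

Lemma cmf_real (h : T -> R) : measurable_fun setT h -> cmf (fun x => (h x)%:C%C).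
Proof. by move=> mh; split => //; exact: measurable_cst. Qed.

Lemma cmf_cis (h : T -> R) : measurable_fun setT h -> cmf (fun x => cis (h x)).
Proof.
move=> mh; split; under eq_fun do rewrite cisE/=.
  apply: measurableT_comp; first exact: (@continuous_measurable_fun _ _ (@continuous_cos R)).
  exact: measurable_funM.
apply: measurableT_comp; first exact: (@continuous_measurable_fun _ _ (@continuous_sin R)).
exact: measurable_funM.
Qed.

Lemma measurable_normc f : cmf f -> measurable_fun setT (fun x => normc (f x)).
Proof.
move=> [f1 f2].
rewrite (_ : (fun _ => _) = fun x => Num.sqrt (Re (f x) ^+ 2 + Im (f x) ^+ 2)); last first.
  by apply/funext => x; rewrite -sqr_normcE sqrtr_sqr ger0_norm ?normc_ge0.
apply: measurableT_comp; first exact: (@continuous_measurable_fun _ _ (@sqrt_continuous R)).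
by apply: measurable_funD; exact: measurable_funX.
Qed.

End measurable_complex.

Lemma cmf_comp (R : realType) d (T : measurableType d) d' (T' : measurableType d')
    (f : T' -> R[i]) (h : T -> T') :
  measurable_fun setT h -> cmf f -> cmf (fun x => f (h x)).
Proof.
by move=> mh [f1 f2]; split; [exact: (measurableT_comp f1 mh)|exact: (measurableT_comp f2 mh)].
Qed.

(** * Integration of complex-valued functions *)

Section complex_integral.
Variable R : realType.
Local Notation mu := (@lebesgue_measure R).
Implicit Types f g : R -> R[i].

Definition rint (h : R -> R) := mu.-integrable [set: R] (EFin \o h).

Definition L1 f := rint (fun x => Re (f x)) /\ rint (fun x => Im (f x)).

Lemma rint_measurable (h : R -> R) : rint h -> measurable_fun setT h.
Proof. by move/measurable_int/measurable_EFinP. Qed.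

Lemma rint_le (h k : R -> R) : measurable_fun setT h -> rint k ->
  (forall x, `|h x| <= k x) -> rint h.
Proof.
move=> mh ik hk; apply: (le_integrable measurableT _ _ ik).
  exact/measurable_EFinP.
by move=> x _ /=; rewrite lee_fin (le_trans (hk x))// ler_norm.
Qed.

Lemma rintD (h k : R -> R) : rint h -> rint k -> rint (fun x => h x + k x).
Proof. by move=> ih ik; exact: (integrableD measurableT ih ik). Qed.

Lemma rintZ c (h : R -> R) : rint h -> rint (fun x => c * h x).
Proof. by move=> ih; exact: (integrableZl measurableT c ih). Qed.

Lemma rint_norm (h : R -> R) : rint h -> rint (fun x => `|h x|).
Proof. by move=> ih; exact: (integrable_norm ih). Qed.

Lemma L1_cmf f : L1 f -> cmf f.
Proof. by case=> *; split; exact: rint_measurable. Qed.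

Lemma L1_le f (k : R -> R) : cmf f -> rint k -> (forall x, normc (f x) <= k x) ->
  L1 f.
Proof.
move=> [f1 f2] ik fk; split; apply: rint_le ik _ => // x; apply: le_trans (fk x).
  exact: normRe_le.
exact: normIm_le.
Qed.

Lemma L1_normc f : L1 f -> rint (fun x => normc (f x)).
Proof.
move=> Lf; have [f1 f2] := Lf.
apply: (rint_le _ (rintD (rint_norm f1) (rint_norm f2))).
  exact/measurable_normc/L1_cmf.
by move=> x; rewrite ger0_norm ?normc_ge0// normc_le.
Qed.

Lemma L1D f g : L1 f -> L1 g -> L1 (fun x => f x + g x).
Proof.
move=> Lf Lg; apply: (L1_le _ (rintD (L1_normc Lf) (L1_normc Lg))).
  by apply: cmfD; exact: L1_cmf.
by move=> x; exact: normcD.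
Qed.

Lemma L1N f : L1 f -> L1 (fun x => - f x).
Proof.
move=> Lf; apply: (L1_le _ (L1_normc Lf)); first exact/cmfN/L1_cmf.
by move=> x; rewrite normcN.
Qed.

Lemma L1B f g : L1 f -> L1 g -> L1 (fun x => f x - g x).
Proof. by move=> Lf /L1N; exact: L1D. Qed.

Lemma L1J f : L1 f -> L1 (fun x => conjc (f x)).
Proof.
move=> Lf; apply: (L1_le _ (L1_normc Lf)); first exact/cmfJ/L1_cmf.
by move=> x; rewrite normc_conjc.
Qed.

Lemma L1M_bounded f g (C : R) : L1 f -> cmf g -> (forall x, normc (g x) <= C) ->
  L1 (fun x => f x * g x).
Proof.
move=> Lf mg gC; apply: (L1_le _ (rintZ C (L1_normc Lf))).
  by apply: cmfM => //; exact: L1_cmf.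
by move=> x; rewrite ComplexField.Normc.normcM mulrC ler_wpM2r ?normc_ge0.
Qed.

Lemma L1Z (c : R[i]) f : L1 f -> L1 (fun x => c * f x).
Proof.
move=> Lf; under eq_fun do rewrite mulrC.
by apply: (L1M_bounded (C := normc c)) => //; exact: cmf_cst.
Qed.

Lemma L1_real (h : R -> R) : rint h -> L1 (fun x => (h x)%:C%C).
Proof.
move=> ih; apply: (L1_le _ (rint_norm ih)).
  by apply: cmf_real; exact: rint_measurable.
by move=> x; rewrite normcR.
Qed.

Lemma eq_cint (D : set R) f g : {in D, f =1 g} -> cint D f = cint D g.
Proof. by move=> fg; congr Complex; apply: eq_Rintegral => x /fg ->. Qed.

Lemma cintD f g : L1 f -> L1 g ->
  cint setT (fun x => f x + g x) = cint setT f + cint setT g.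
Proof.
move=> [f1 f2] [g1 g2]; apply: complex_ext.
  by rewrite ReD /= -RintegralD//; apply: eq_Rintegral => x _; rewrite ReD.
by rewrite ImD /= -RintegralD//; apply: eq_Rintegral => x _; rewrite ImD.
Qed.

Lemma cintZ (c : R[i]) f : L1 f -> cint setT (fun x => c * f x) = c * cint setT f.
Proof.
move=> [f1 f2]; apply: complex_ext.
  rewrite ReM /= -!RintegralZl// -RintegralB//; [|exact: rintZ..].
  by apply: eq_Rintegral => x _; rewrite ReM.
rewrite ImM /= -!RintegralZl// -RintegralD//; [|exact: rintZ..].
by apply: eq_Rintegral => x _; rewrite ImM.
Qed.

Lemma cintN f : L1 f -> cint setT (fun x => - f x) = - cint setT f.
Proof.
by move=> Lf; rewrite -[RHS]mulN1r -cintZ//; apply: eq_cint => x _; rewrite mulN1r.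
Qed.

Lemma cintB f g : L1 f -> L1 g ->
  cint setT (fun x => f x - g x) = cint setT f - cint setT g.
Proof. by move=> Lf Lg; rewrite cintD ?cintN//; exact: L1N. Qed.

Lemma cintJ f : L1 f -> cint setT (fun x => conjc (f x)) = conjc (cint setT f).
Proof.
move=> [f1 f2]; apply: complex_ext => /=.
  by apply: eq_Rintegral => x _; rewrite ReJ.
rewrite -mulN1r -RintegralZl//; apply: eq_Rintegral => x _.
by rewrite ImJ mulN1r.
Qed.

Lemma cint_real (h : R -> R) : cint setT (fun x => (h x)%:C%C) = (\int[mu]_x h x)%:C%C.
Proof. by congr Complex; rewrite /= /Rintegral integral0. Qed.

(* The factor 2 comes from bounding the real and imaginary parts separately. *)
Lemma normc_cint_le f (k : R -> R) : L1 f -> rint k -> (forall x, normc (f x) <= k x) ->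
  normc (cint setT f) <= 2 * \int[mu]_x k x.
Proof.
move=> [f1 f2] ik fk; rewrite (le_trans (normc_le _))// mulr_natl mulr2n lerD//=;
  rewrite (le_trans (le_normr_Rintegral measurableT _))//;
  apply: le_Rintegral => //; try exact: rint_norm.
- by move=> x _; rewrite (le_trans (normRe_le _)).
- by move=> x _; rewrite (le_trans (normIm_le _)).
Qed.

Lemma rint_fine (h : R -> R) : rint h -> (\int[mu]_x (h x)%:E)%E = (\int[mu]_x h x)%:E.
Proof. by move=> ih; rewrite fineK//; exact: integrable_fin_num. Qed.

(** Section integrability is asked at every point, so that each inner [Rintegral] is a true integral
    and never the default value of [fine]. The majorant [h] gives finiteness of the iterated
    integral, hence integrability on the product. *)
Lemma rint_Fubini (k : R -> R -> R) (h : R -> R) :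
  measurable_fun [set: R * R] (fun z => k z.1 z.2) ->
  (forall x, rint (k x)) -> (forall y, rint (k ^~ y)) ->
  rint h -> (forall x, \int[mu]_y `|k x y| <= h x) ->
  [/\ rint (fun x => \int[mu]_y k x y), rint (fun y => \int[mu]_x k x y) &
     \int[mu]_x (\int[mu]_y k x y) = \int[mu]_y (\int[mu]_x k x y)].
Proof.
move=> mk ik1 ik2 ih kh.
pose K (z : R * R) := (k z.1 z.2)%:E.
have mK : measurable_fun setT K by exact/measurable_EFinP.
(* With the swapped kernel, the result on first marginals also yields integrability of the second
   marginal. *)
pose K' (z : R * R) := (k z.2 z.1)%:E.
have mK' : measurable_fun setT K'.
  apply/measurable_EFinP; apply: (measurableT_comp mk (g := fun z => (z.2, z.1))).
  by apply/measurable_fun_pairP; split; [exact: measurable_snd|exact: measurable_fst].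
have Kfin : (\int[mu]_x \int[mu]_y `|K (x, y)| < +oo)%E.
  apply: (@le_lt_trans _ _ (\int[mu]_x (h x)%:E)%E); last first.
    by rewrite rint_fine// ltry.
  apply: ge0_le_integral => //.
  - by move=> x _; apply: integral_ge0.
  - have mKa : measurable_fun setT (abse \o K) by exact: measurableT_comp.
    exact: (measurable_fun_fubini_tonelli_F (m2 := mu) (abse \o K) mKa (fun=> abse_ge0 _)).
  - by apply/measurable_EFinP; exact: rint_measurable.
  - move=> x _; have := kh x; rewrite -lee_fin -rint_fine//.
    exact: rint_norm.
have iK : (mu \x mu)%E.-integrable setT K by exact/(integrable12ltyP mu mu mK).
have iK' : (mu \x mu)%E.-integrable setT K' by exact/(integrable21ltyP mu mu mK').
have EF x : (\int[mu]_y K (x, y))%E = (\int[mu]_y k x y)%:E.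
  exact: rint_fine (ik1 x).
have EG y : (\int[mu]_x K (x, y))%E = (\int[mu]_x k x y)%:E.
  exact: rint_fine (ik2 y).
have iF := integrable_fubini_F iK; have iG := integrable_fubini_F iK'.
have iF' : rint (fun x => \int[mu]_y k x y).
  by apply: (@eq_integrable _ _ _ mu _ measurableT _ _ _ iF) => x _; exact: EF.
have iG' : rint (fun y => \int[mu]_x k x y).
  by apply: (@eq_integrable _ _ _ mu _ measurableT _ _ _ iG) => y _; exact: EG.
split; [exact: iF'|exact: iG'|rewrite /Rintegral; congr fine].
have <- : (\int[mu]_x \int[mu]_y K (x, y) = \int[mu]_x (\int[mu]_y k x y)%:E)%E.
  by apply: eq_integral => x _; exact: EF.
have <- : (\int[mu]_y \int[mu]_x K (x, y) = \int[mu]_y (\int[mu]_x k x y)%:E)%E.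
  by apply: eq_integral => y _; exact: EG.
exact: Fubini iK.
Qed.

Lemma cint_Fubini (K : R -> R -> R[i]) (h : R -> R) :
  cmf (fun z : R * R => K z.1 z.2) ->
  (forall x, L1 (K x)) -> (forall y, L1 (K ^~ y)) ->
  rint h -> (forall x, \int[mu]_y normc (K x y) <= h x) ->
  [/\ L1 (fun x => cint setT (K x)), L1 (fun y => cint setT (K ^~ y)) &
     cint setT (fun x => cint setT (K x)) = cint setT (fun y => cint setT (K ^~ y))].
Proof.
move=> [mK1 mK2] iK1 iK2 ih Kh.
have [a1 a2 a3] := @rint_Fubini (fun x y => Re (K x y)) h mK1
  (fun x => (iK1 x).1) (fun y => (iK2 y).1) ih (fun x => le_trans
    (le_Rintegral measurableT (rint_norm (iK1 x).1) (L1_normc (iK1 x))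
      (fun y _ => normRe_le (K x y))) (Kh x)).
have [b1 b2 b3] := @rint_Fubini (fun x y => Im (K x y)) h mK2
  (fun x => (iK1 x).2) (fun y => (iK2 y).2) ih (fun x => le_trans
    (le_Rintegral measurableT (rint_norm (iK1 x).2) (L1_normc (iK1 x))
      (fun y _ => normIm_le (K x y))) (Kh x)).
by split; rewrite /L1 /cint /=; [split; [exact a1|exact b1]|split; [exact a2|exact b2]|rewrite a3 b3].
Qed.

(** * Invariance of the integral under reflections and translations *)

Lemma measurable_reflect (a : R) : measurable_fun setT (fun x : R => a - x).
Proof. exact: measurable_funB. Qed.

(** By uniqueness of the measure it suffices to look at half-open intervals; a reflection only moves
    the open end to the other side, which keeps the length. *)
Lemma lebesgue_measure_reflect (a : R) (A : set R) : measurable A ->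
  pushforward mu ((fun x => a - x) : R -> measurableTypeR R) A = mu A.
Proof.
move=> mA; apply/esym/lebesgue_measure_unique => //=.
  exact: measurable_reflect.
move=> mr _ [[x y] _ <-]; rewrite /pushforward.
rewrite (_ : _ @^-1` _ = `[a - y, a - x[%classic); last first.
  by apply/seteqP; split => t /=; rewrite !in_itv/=; lra.
rewrite !lebesgue_measure_itv/= !lte_fin ltrD2l ltrN2 -!EFinD.
by congr (if _ then _%:E else _); ring.
Qed.

Lemma rint_reflect (a : R) (h : R -> R) : rint h ->
  rint (fun x => h (a - x)) /\ \int[mu]_x h (a - x) = \int[mu]_x h x.
Proof.
move=> ih; have mh := rint_measurable ih.
have mha : measurable_fun setT (fun x : R => h (a - x)).
  exact: (measurableT_comp mh (measurable_reflect a)).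
have pf (k : R -> \bar R) : (\int[pushforward mu ((fun x => a - x)%R : R -> measurableTypeR R)]_x k x = \int[mu]_x k x)%E.
  apply: eq_measure_integral; first exact: measurable_reflect.
  by move=> m A mA _ /=; exact: lebesgue_measure_reflect.
have iha : rint (fun x => h (a - x)).
  apply/integrableP; split; first exact/measurable_EFinP.
  move/integrableP : ih => [_]; rewrite -pf ge0_integral_pushforward//.
    exact: measurable_reflect.
  by apply/measurable_EFinP; exact: measurableT_comp.
split=> //; rewrite /Rintegral -[in RHS]pf integral_pushforward//.
  exact: measurable_reflect.
exact/measurable_EFinP.
Qed.

Lemma cint_reflect (a : R) f : L1 f ->
  L1 (fun x => f (a - x)) /\ cint setT (fun x => f (a - x)) = cint setT f.
Proof.
move=> [f1 f2]; have [i1 e1] := rint_reflect a f1; have [i2 e2] := rint_reflect a f2.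
by split=> //; apply: complex_ext.
Qed.

(** A translation is the composite of the reflections about [0] and [a / 2]. *)
Lemma rint_shift (a : R) (h : R -> R) : rint h ->
  rint (fun x => h (x - a)) /\ \int[mu]_x h (x - a) = \int[mu]_x h x.
Proof.
move=> ih; have [i1 e1] := rint_reflect 0 ih.
have [i2 e2] := rint_reflect a i1.
rewrite -e1 -e2 (_ : (fun x => h (x - a)) = fun x => h (0 - (a - x)))//.
by apply/funext => x; rewrite sub0r opprB.
Qed.

Lemma cint_shift (a : R) f : L1 f ->
  L1 (fun x => f (x - a)) /\ cint setT (fun x => f (x - a)) = cint setT f.
Proof.
move=> [f1 f2]; have [i1 e1] := rint_shift a f1; have [i2 e2] := rint_shift a f2.
by split=> //; apply: complex_ext.
Qed.

End complex_integral.

(** * Fourier transform and convolution *)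

Section fourier.
Variable R : realType.
Local Notation mu := (@lebesgue_measure R).
Implicit Types f g u v w : R -> R[i].

(** Tonelli applies to the positive and negative parts separately, and [fine] preserves
    measurability. *)
Lemma measurable_Rintegral (k : R -> R -> R) :
  measurable_fun [set: R * R] (fun z => k z.1 z.2) ->
  measurable_fun setT (fun x => \int[mu]_y k x y).
Proof.
move=> mk; rewrite /Rintegral; apply: measurableT_comp => //.
pose K (z : R * R) := (k z.1 z.2)%:E.
have mK : measurable_fun setT K by exact/measurable_EFinP.
under eq_fun do rewrite integralE.
apply: emeasurable_funB.
- have := measurable_fun_fubini_tonelli_F (m2 := mu) (K^\+)%E (measurable_funepos mK)
    (fun z => funepos_ge0 K z).
  apply: eq_measurable_fun => x _; apply: eq_integral => y _.
  by rewrite ?funeposE ?funenegE.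
- have := measurable_fun_fubini_tonelli_F (m2 := mu) (K^\-)%E (measurable_funeneg mK)
    (fun z => funeneg_ge0 K z).
  apply: eq_measurable_fun => x _; apply: eq_integral => y _.
  by rewrite ?funeposE ?funenegE.
Qed.

Lemma cmf_cint (K : R -> R -> R[i]) : cmf (fun z : R * R => K z.1 z.2) ->
  cmf (fun x => cint setT (K x)).
Proof. by move=> [K1 K2]; split; exact: measurable_Rintegral. Qed.

Lemma cmf_fst (f : R -> R[i]) : cmf f -> cmf (fun z : R * R => f z.1).
Proof. by apply: cmf_comp; exact: measurable_fst. Qed.

Lemma cmf_snd (f : R -> R[i]) : cmf f -> cmf (fun z : R * R => f z.2).
Proof. by apply: cmf_comp; exact: measurable_snd. Qed.

Lemma cmf_pair1 (k : R -> R -> R[i]) x : cmf (fun z : R * R => k z.1 z.2) -> cmf (k x).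
Proof. by apply: (cmf_comp (h := pair x)); exact: measurable_pair1. Qed.

Lemma cmf_pair2 (k : R -> R -> R[i]) y : cmf (fun z : R * R => k z.1 z.2) -> cmf (k ^~ y).
Proof. by apply: (cmf_comp (h := pair^~ y)); exact: measurable_pair2. Qed.

(** The kernel is a character in [ft_mult] and a Poisson kernel in [ft_eq0_itv]. *)
Lemma cint_Fubini_bounded u w (k : R -> R -> R[i]) (C : R) : L1 u -> L1 w ->
  cmf (fun z : R * R => k z.1 z.2) -> (forall x y, normc (k x y) <= C) ->
  [/\ L1 (fun x => w x * cint setT (fun y => u y * k x y)),
     L1 (fun y => u y * cint setT (fun x => w x * k x y)) &
     cint setT (fun x => w x * cint setT (fun y => u y * k x y)) =
     cint setT (fun y => u y * cint setT (fun x => w x * k x y))].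
Proof.
move=> Lu Lw mk kC.
pose K x y := w x * (u y * k x y).
have C0 : 0 <= C by rewrite (le_trans _ (kC 0 0))// normc_ge0.
have Luk x : L1 (fun y => u y * k x y).
  by apply: L1M_bounded (kC x) => //; exact: cmf_pair1.
have Lwk y : L1 (fun x => w x * k x y).
  by apply: L1M_bounded (kC ^~ y) => //; exact: cmf_pair2.
have KE y : K ^~ y = fun x => u y * (w x * k x y) by apply/funext => x; rewrite /K; ring.
have [] := @cint_Fubini R K (fun x => normc (w x) * (C * \int[mu]_y normc (u y))).
- apply: cmfM; first by apply: cmf_fst; exact: L1_cmf.
  by apply: cmfM => //; apply: cmf_snd; exact: L1_cmf.
- by move=> x; apply: L1Z.
- by move=> y; rewrite KE; exact: L1Z.
- under eq_fun do rewrite mulrC; apply: rintZ; exact: L1_normc.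
- move=> x; rewrite -RintegralZl//; last exact: L1_normc.
  rewrite -RintegralZl//; last by apply: rintZ; exact: L1_normc.
  apply: le_Rintegral => //.
  + by apply: L1_normc; exact: L1Z.
  + by do 2 apply: rintZ; exact: L1_normc.
  + move=> y _; rewrite /K !ComplexField.Normc.normcM ler_wpM2l ?normc_ge0// mulrC.
    by rewrite ler_wpM2r ?normc_ge0.
under eq_fun do rewrite cintZ//.
under [X in _ -> L1 X -> _]eq_fun do rewrite KE cintZ//.
by under [X in _ -> _ -> _ = cint _ X -> _]eq_fun do rewrite KE cintZ//; split.
Qed.

(* The kernel is [exp (2 i pi t x)], without the minus sign of [STFT]. *)
Definition ft u (x : R) : R[i] := cint setT (fun t => u t * cis (t * x)).

Lemma cmf_cisM : cmf (fun z : R * R => cis (z.2 * z.1)).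
Proof. by apply: cmf_cis; apply: measurable_funM. Qed.

Lemma L1_cis u x : L1 u -> L1 (fun t => u t * cis (t * x)).
Proof.
move=> Lu; apply: (L1M_bounded (C := 1)) => //.
  by apply: cmf_cis; exact: measurable_funM.
by move=> y; rewrite normc_cis.
Qed.

Lemma cmf_ft u : L1 u -> cmf (ft u).
Proof.
move=> Lu; apply: (cmf_cint (K := fun x t => u t * cis (t * x))).
by apply: cmfM; [apply: cmf_snd; exact: L1_cmf|exact: cmf_cisM].
Qed.

Lemma normc_ft_le u x : L1 u -> normc (ft u x) <= 2 * \int[mu]_t normc (u t).
Proof.
move=> Lu; apply: normc_cint_le; [exact: L1_cis|exact: L1_normc|] => t.
by rewrite ComplexField.Normc.normcM normc_cis mulr1.
Qed.

Lemma ftB u v x : L1 u -> L1 v -> ft (fun t => u t - v t) x = ft u x - ft v x.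
Proof.
move=> Lu Lv; rewrite -cintB; [|exact: L1_cis..].
by apply: eq_cint => t _; rewrite mulrBl.
Qed.

Lemma ft_shift u a x : L1 u -> ft (fun t => u (t - a)) x = cis (a * x) * ft u x.
Proof.
move=> Lu; rewrite {2}/ft; have [_ <-] := cint_shift a (L1_cis x Lu).
rewrite -cintZ; last by have [] := cint_shift a (L1_cis x Lu).
apply: eq_cint => t _; rewrite mulrCA -cisD; congr (_ * cis _); ring.
Qed.

Lemma ft_conj_reflect u x : L1 u -> ft (fun t => conjc (u (0 - t))) x = conjc (ft u x).
Proof.
move=> Lu; rewrite {2}/ft -cintJ; last exact: L1_cis.
have [_ <-] := cint_reflect 0 (L1J (L1_cis x Lu)).
apply: eq_cint => t _; rewrite sub0r conjcM -cisN.
by congr (_ * cis _); ring.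
Qed.

(** The multiplication formula: the kernel is symmetric in its two variables. With [w] an Abel
    factor, [ft w] is an explicit Poisson kernel; with [w] a shifted window, it links the
    spectrogram to the spectrum. *)
Lemma ft_mult u w : L1 u -> L1 w ->
  cint setT (fun x => ft u x * w x) = cint setT (fun t => u t * ft w t).
Proof.
move=> Lu Lw; have c1 x y : normc (cis (y * x : R)) <= 1 by rewrite normc_cis.
have [_ _] := @cint_Fubini_bounded u w (fun x y => cis (y * x)) 1 Lu Lw cmf_cisM c1.
move=> E; transitivity (cint setT (fun x => w x * ft u x)).
  by apply: eq_cint => x _; rewrite mulrC.
rewrite E; apply: eq_cint => t _; congr (_ * _).
by apply: eq_cint => x _; rewrite (mulrC t).
Qed.

(** * Square integrable functions and convolution *)

Lemma L2_L1M u v : L2 u -> L2 v -> L1 (fun t => u t * v t).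
Proof.
move=> [u1 [u2 u3]] [v1 [v2 v3]]; apply: L1_le (rintD u3 v3) _.
  exact: cmfM.
move=> t; rewrite ComplexField.Normc.normcM.
have := sqr_ge0 (normc (u t) - normc (v t)).
by have := normc_ge0 (u t); have := normc_ge0 (v t); nra.
Qed.

Lemma L2_comp u (h : R -> R) : measurable_fun setT h ->
  (forall k : R -> R, rint k -> rint (fun x => k (h x))) -> L2 u -> L2 (fun x => u (h x)).
Proof.
move=> mh ih [u1 [u2 u3]]; split; first exact: (measurableT_comp u1 mh).
by split; [exact: (measurableT_comp u2 mh)|exact: (ih _ u3)].
Qed.

Lemma L2_reflect u a : L2 u -> L2 (fun t => u (a - t)).
Proof.
apply: L2_comp; first exact: measurable_reflect.
by move=> k /(rint_reflect a)[].
Qed.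

Lemma L2_shift u a : L2 u -> L2 (fun t => u (t - a)).
Proof.
apply: L2_comp; first exact: measurable_funB.
by move=> k /(rint_shift a)[].
Qed.

Lemma L2_conj u : L2 u -> L2 (fun t => conjc (u t)).
Proof.
move=> [u1 [u2 u3]]; have [v1 v2] := cmfJ (conj u1 u2).
by do 2 split => //; under eq_fun do rewrite normc_conjc.
Qed.

Definition conv u v (y : R) : R[i] := cint setT (fun t => u t * v (y - t)).

(** The [L1] hypotheses provide the absolute convergence for Fubini. The [L2] hypotheses make the
    integral defining [conv u v y] converge at every [y], as [cint_Fubini] demands, and not just at
    almost every one. *)
Lemma conv_ft u v : L1 u -> L2 u -> L1 v -> L2 v ->
  L1 (conv u v) /\ forall x, ft (conv u v) x = ft u x * ft v x.
Proof.
move=> Lu L2u Lv L2v.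
have Luv y : L1 (fun t => u t * v (y - t)) by apply: L2_L1M => //; exact: L2_reflect.
(* Integrability of [conv u v] itself is the case [x = 0], where the character is 1. *)
suff H x : L1 (fun y => conv u v y * cis (y * x)) /\
    cint setT (fun y => conv u v y * cis (y * x)) = ft u x * ft v x.
  split; last by move=> x; have [] := H x.
  have [+ _] := H 0; rewrite (_ : (fun y => _) = conv u v)//.
  by apply/funext => y; rewrite mulr0 cis0 mulr1.
pose K t y := u t * (v (y - t) * cis (y * x)).
have Lvs t : L1 (fun y => v (y - t)) by have [] := cint_shift t Lv.
have KE y : K ^~ y = fun t => cis (y * x) * (u t * v (y - t)).
  by apply/funext => t; rewrite /K; ring.
have msub : measurable_fun setT (fun z : R * R => z.2 - z.1) by exact: measurable_funB.
have [] := @cint_Fubini R K (fun t => (\int[mu]_y normc (v y)) * normc (u t)).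
- apply: cmfM; first by apply: cmf_fst; exact: L1_cmf.
  apply: cmfM; first by apply: (cmf_comp msub); exact: L1_cmf.
  by apply: cmf_cis; apply: measurable_funM.
- by move=> t; apply: L1Z; exact: L1_cis.
- by move=> y; rewrite KE; exact: L1Z.
- by apply: rintZ; exact: L1_normc.
- move=> t; have [i1 <-] := rint_shift t (L1_normc Lv).
  rewrite mulrC -RintegralZl// le_eqVlt; apply/orP; left; apply/eqP.
  apply: eq_Rintegral => y _.
  by rewrite /K !ComplexField.Normc.normcM normc_cis mulr1.
move=> _; under eq_fun do rewrite KE cintZ// mulrC.
move=> H1 H2; split=> //; rewrite -H2.
under eq_fun => t.
  rewrite cintZ; last exact: L1_cis.
  rewrite -/(ft (fun y => v (y - t)) x) ft_shift// mulrA mulrC.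
  over.
by rewrite cintZ 1?mulrC//; exact: L1_cis.
Qed.

End fourier.

(** * Poisson kernel and Fourier uniqueness *)

Section poisson_kernel.
Variable R : realType.
Local Notation mu := (@lebesgue_measure R).

Lemma is_derive_continuous (F f : R -> R) :
  (forall x : R, is_derive x (1 : R) F (f x)) -> continuous F.
Proof. by move=> dF x; apply/differentiable_continuous/derivable1_diffP; case: (dF x). Qed.

Lemma Rintegral_is_derive (F f : R -> R) (a b : R) : a < b ->
  (forall x : R, is_derive x (1 : R) F (f x)) -> continuous f ->
  \int[mu]_(x in `[a, b]) f x = F b - F a.
Proof.
move=> ab dF cf; rewrite /Rintegral (@continuous_FTC2 _ f F)//.
- exact: continuous_subspaceT.
- have cF := is_derive_continuous dF; split.
  + by move=> x _; case: (dF x).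
  + exact/cvg_at_right_filter/cF.
  + exact/cvg_at_left_filter/cF.
- by move=> x _; rewrite derive1E; exact: (@derive_val _ _ _ _ _ _ _ (dF x)).
Qed.

Lemma is_derive_comp_linear (F f : R -> R) (c : R) :
  (forall x : R, is_derive x (1 : R) F (f x)) ->
  forall x : R, is_derive x (1 : R) (fun y => F (c * y)) (c * f (c * x)).
Proof.
move=> dF x; have dc : is_derive x (1 : R) (fun y : R => c * y) c.
  by apply: is_derive_eq; rewrite /GRing.scale/= mulr1.
have := @is_derive1_comp R F (fun y => c * y) x _ _ (dF _) dc.
by rewrite mulrC.
Qed.

Section laplace_cos.
Variables (c a : R).
Hypothesis c0 : 0 < c.

(* The summand 1 makes the integrand nonnegative, as required by the available
   improper fundamental theorem of calculus. *)
Let f (x : R) := expR (- c * x) * (1 + cos (a * x)).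
(** Two integrations by parts show that [expR (- c * x) * g x] is the primitive of [f] that vanishes
    at infinity. *)
Let g (x : R) := - c^-1 + (c ^+ 2 + a ^+ 2)^-1 * (a * sin (a * x) - c * cos (a * x)).

Let D0 : c ^+ 2 + a ^+ 2 != 0.
Proof. by rewrite gt_eqF// ltr_wpDr ?sqr_ge0// exprn_gt0. Qed.

Let dF (x : R) : is_derive x (1 : R) (fun y => expR (- c * y) * g y) (f x).
Proof.
have d1 := is_derive_comp_linear (- c) (@is_derive_expR R) x.
have d2 := is_derive_comp_linear a (@is_derive_sin R) x.
have d3 := is_derive_comp_linear a (@is_derive_cos R) x.
rewrite /g; apply: is_derive_eq; rewrite /f /g /GRing.scale/=.
field.
by rewrite D0 gt_eqF.
Qed.

Let cvgF : expR (- c * x) * g x @[x --> +oo] --> (0 : R).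
Proof.
pose M := `|c^-1| + `|(c ^+ 2 + a ^+ 2)^-1| * (`|a| + `|c|).
have gM x : `|g x| <= M.
  rewrite (le_trans (ler_normD _ _))// normrN lerD// normrM ler_wpM2l//.
  rewrite (le_trans (ler_normB _ _))// !normrM lerD// ler_piMr//.
    by rewrite ler_norml sin_geN1 sin_le1.
  by rewrite ler_norml cos_geN1 cos_le1.
have cE : expR (- c * x) @[x --> +oo] --> (0 : R).
  have : expR (- (c * x)) @[x --> +oo] --> (0 : R).
    by apply: (cvg_comp _ _ _ (@cvgr_expR R)); apply: gt0_cvgMry => //; exact: cvg_id.
  by under eq_fun do rewrite -mulNr.
apply: (@squeeze_cvgr _ _ _ _ (fun x => - M * expR (- c * x)) (fun x => M * expR (- c * x))).
- near=> x; rewrite mulNr -ler_norml normrM (ger0_norm (expR_ge0 _)) mulrC.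
  by rewrite ler_wpM2r ?expR_ge0.
- by rewrite -(mulr0 (- M)); apply: cvgM => //; exact: cvg_cst.
- by rewrite -(mulr0 M); apply: cvgM => //; exact: cvg_cst.
Unshelve. all: by end_near. Qed.

Let cE (y : R) : continuous (fun x : R => expR (- y * x)).
Proof. exact: is_derive_continuous (is_derive_comp_linear (- y) (@is_derive_expR R)). Qed.

Let cC : continuous (fun x : R => 1 + cos (a * x)).
Proof.
move=> x; apply: continuousD; first exact: cst_continuous.
exact: (is_derive_continuous (is_derive_comp_linear a (@is_derive_cos R))).
Qed.

Let cosD_ge0 x : 0 <= 1 + cos (a * x).
Proof. have := cos_geN1 (a * x); lra. Qed.

Lemma integral_exp_oneDcos :
  (\int[mu]_x (expR (- c * `|x|) * (1 + cos (a * x)))%:E)%E =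
  (2 * (c^-1 + c / (c ^+ 2 + a ^+ 2)))%:E.
Proof.
have cf : continuous f by move=> x; apply: cvgM; [exact: cE|exact: cC].
have cN : continuous (fun x : R => expR (- c * `|x|)).
  move=> x; apply: (@continuous_comp R R R (fun y => `|y|) (fun y => expR (- c * y))).
    exact: (@norm_continuous _ R).
  exact: cE.
rewrite ge0_symfun_integralT; first last.
- by move=> x /=; rewrite normrN mulrN cosN.
- by move=> x; apply: cvgM; [exact: cN|exact: cC].
- by move=> x; rewrite mulr_ge0 ?expR_ge0.
rewrite EFinM; congr (_ * _)%E.
rewrite -set_itvcy.
transitivity (\int[mu]_(x in `[0%R, +oo[) (f x)%:E)%E.
  by apply: eq_integral => x; rewrite inE/= in_itv/= andbT => x0; rewrite /f (ger0_norm x0).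
have cF := is_derive_continuous dF.
rewrite (@ge0_continuous_FTC2y _ f (fun y => expR (- c * y) * g y) 0 0)//.
- rewrite sub0e -EFinN; congr EFin; rewrite /g !mulr0 expR0 sin0 cos0.
  by field; rewrite D0 gt_eqF.
- by move=> x _; rewrite mulr_ge0 ?expR_ge0.
- exact: continuous_subspaceT.
- exact/cvg_at_right_filter/cF.
- by move=> x _; rewrite derive1E; exact: (@derive_val _ _ _ _ _ _ _ (dF x)).
Qed.

Lemma measurable_exp_norm : measurable_fun setT (fun x : R => expR (- c * `|x|)).
Proof.
apply: measurableT_comp => //.
by apply: measurable_funM => //; exact: measurableT_comp.
Qed.

End laplace_cos.

(** The case [a = 0], where [1 + cos] is the constant 2. *)
Lemma rint_exp_norm (c : R) : 0 < c ->
  rint (fun x => expR (- c * `|x|)) /\ \int[mu]_x expR (- c * `|x|) = 2 / c.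
Proof.
move=> c0; have := integral_exp_oneDcos 0 c0.
have Ec x : (expR (- c * `|x|) * (1 + cos (0 * x)))%:E = (2%:E * (expR (- c * `|x|))%:E)%E.
  by rewrite mul0r cos0 -EFinM mulrC.
have mE := measurable_exp_norm c.
have -> : (\int[mu]_x (expR (- c * `|x|) * (1 + cos (0 * x)))%:E =
    2%:E * \int[mu]_x (expR (- c * `|x|))%:E)%E.
  rewrite -ge0_integralZl//.
  - by apply: eq_integral => x _; exact: Ec.
  - exact/measurable_EFinP.
move=> E2.
have E : (\int[mu]_x (expR (- c * `|x|))%:E)%E = (2 / c)%:E.
  have := congr1 (fun x => 2^-1%:E * x)%E E2.
  rewrite muleA -!EFinM mulVf// mul1e => ->; congr EFin.
  by field; rewrite gt_eqF.
split; last by rewrite /Rintegral E.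
apply/integrableP; split; first exact/measurable_EFinP.
under eq_integral do rewrite gee0_abs ?lee_fin ?expR_ge0//.
by rewrite E ltry.
Qed.

(** Subtracting the integral [2 / c] of the bare exponential takes the auxiliary summand 1 away
    again. *)
Lemma Rintegral_exp_cos (c a : R) : 0 < c ->
  \int[mu]_x (expR (- c * `|x|) * cos (a * x)) = 2 * c / (c ^+ 2 + a ^+ 2).
Proof.
move=> c0; have [iE E] := rint_exp_norm c0.
have mC : measurable_fun setT (fun x : R => cos (a * x)).
  apply: continuous_measurable_fun.
  exact: (is_derive_continuous (is_derive_comp_linear a (@is_derive_cos R))).
have iC : rint (fun x => expR (- c * `|x|) * cos (a * x)).
  apply: (rint_le _ iE).
    by apply: measurable_funM => //; exact: rint_measurable.
  move=> x; rewrite normrM (ger0_norm (expR_ge0 _)) ler_piMr ?expR_ge0//.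
  by rewrite ler_norml cos_geN1 cos_le1.
have /(congr1 fine)/= := integral_exp_oneDcos a c0.
rewrite -/(Rintegral _ _ _).
under eq_Rintegral do rewrite mulrDr mulr1.
rewrite RintegralD// E => /(canRL (addKr _)) ->.
have D0 : c ^+ 2 + a ^+ 2 != 0 by rewrite gt_eqF// ltr_wpDr ?sqr_ge0// exprn_gt0.
by field; rewrite D0 gt_eqF.
Qed.

Lemma Rintegral_exp_sin (c a : R) : 0 < c ->
  \int[mu]_x (expR (- c * `|x|) * sin (a * x)) = 0.
Proof.
move=> c0; have [iE E] := rint_exp_norm c0.
have mC : measurable_fun setT (fun x : R => sin (a * x)).
  apply: continuous_measurable_fun.
  exact: (is_derive_continuous (is_derive_comp_linear a (@is_derive_sin R))).
have iC : rint (fun x => expR (- c * `|x|) * sin (a * x)).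
  apply: (rint_le _ iE).
    by apply: measurable_funM => //; exact: rint_measurable.
  move=> x; rewrite normrM (ger0_norm (expR_ge0 _)) ler_piMr ?expR_ge0//.
  by rewrite ler_norml sin_geN1 sin_le1.
have [_] := rint_reflect 0 iC.
under eq_Rintegral do rewrite sub0r normrN mulrN sinN mulrN -mulN1r.
rewrite RintegralZl// mulN1r; lra.
Qed.

Definition poisson (e y : R) := e / (pi * (e ^+ 2 + y ^+ 2)).
Definition abel (e x : R) : R := expR (- (2 * pi * e) * `|x|).

Let pi0 : (pi : R) != 0. Proof. by rewrite gt_eqF ?pi_gt0. Qed.

Lemma rint_abel e : 0 < e -> rint (abel e).
Proof. by move=> e0; have [] := @rint_exp_norm (2 * pi * e); rewrite ?mulr_gt0 ?pi_gt0. Qed.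

Lemma ft_abel e y : 0 < e -> ft (fun x => (abel e x)%:C%C) y = (poisson e y)%:C%C.
Proof.
move=> e0; have c0 : 0 < 2 * pi * e by rewrite !mulr_gt0 ?pi_gt0.
have D0 : e ^+ 2 + y ^+ 2 != 0 by rewrite gt_eqF// ltr_wpDr ?sqr_ge0// exprn_gt0.
apply: complex_ext.
  transitivity (\int[mu]_x (abel e x * cos ((2 * pi * y) * x))).
    apply: eq_Rintegral => x _; rewrite ReM cisE/= mul0r subr0.
    by congr (_ * cos _); ring.
  rewrite Rintegral_exp_cos// /poisson /=.
  move: pi0; generalize (pi : R) => p p0.
  rewrite (_ : (2 * p * e) ^+ 2 + _ = (2 * p) ^+ 2 * (e ^+ 2 + y ^+ 2)); last by ring.
  by field; rewrite D0 p0.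
transitivity (\int[mu]_x (abel e x * sin ((2 * pi * y) * x))).
  apply: eq_Rintegral => x _; rewrite ImM cisE/= mul0r addr0.
  by congr (_ * sin _); ring.
exact: Rintegral_exp_sin.
Qed.

End poisson_kernel.

Section uniqueness.
Variable R : realType.
Local Notation mu := (@lebesgue_measure R).

Let pi0 : (pi : R) != 0. Proof. by rewrite gt_eqF ?pi_gt0. Qed.

Lemma poisson_ge0 (e y : R) : 0 < e -> 0 <= poisson e y.
Proof.
move=> e0; apply: divr_ge0; first exact: ltW.
by rewrite mulr_ge0 ?pi_ge0// addr_ge0 ?sqr_ge0.
Qed.

(** The right-hand side is the value at [y = 0]. It blows up as [e] tends to 0, but serves only to
    obtain integrability at fixed [e]. *)
Lemma poisson_le (e y : R) : 0 < e -> poisson e y <= e / (pi * e ^+ 2).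
Proof.
move=> e0; have h0 : 0 < e ^+ 2 by rewrite exprn_gt0.
have h1 : 0 < e ^+ 2 + y ^+ 2 by rewrite ltr_wpDr ?sqr_ge0.
rewrite /poisson ler_pM2l// lef_pV2 ?posrE ?(mulr_gt0 (pi_gt0 R))//.
by rewrite ler_pM2l ?pi_gt0// lerDl sqr_ge0.
Qed.

Lemma continuous_poisson (e : R) : 0 < e -> continuous (poisson e).
Proof.
move=> e0 y; apply: cvgM; first exact: cvg_cst.
apply: cvgV.
  by rewrite mulf_neq0// gt_eqF// ltr_wpDr ?sqr_ge0// exprn_gt0.
apply: cvgM; first exact: cvg_cst.
by apply: cvgD; [exact: cvg_cst|exact: exprn_continuous].
Qed.

Lemma Rintegral_poisson (a b e t : R) : a < b -> 0 < e ->
  \int[mu]_(s in `[a, b]) poisson e (t - s) =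
  pi^-1 * (atan ((b - t) / e) - atan ((a - t) / e)).
Proof.
move=> ab e0.
have dF (s : R) : is_derive s (1 : R) (fun s => pi^-1 * atan ((s - t) / e)) (poisson e (t - s)).
  have d1 : is_derive s (1 : R) (fun y : R => (y - t) / e) e^-1.
    by apply: is_derive_eq; rewrite /GRing.scale/= !mulr0 add0r oppr0 addr0 mulr1.
  have d2 := @is_derive1_comp R (@atan R) (fun y => (y - t) / e) s _ _ (is_derive1_atan _) d1.
  have := is_deriveZ (pi^-1 : R) d2.
  rewrite /GRing.scale/=.
  rewrite (_ : pi^-1 * _ = poisson e (t - s))//.
  have D1 : 1 + ((s - t) / e) ^+ 2 != 0 by rewrite gt_eqF// ltr_wpDr ?sqr_ge0.
  have D2 : e ^+ 2 + (t - s) ^+ 2 != 0 by rewrite gt_eqF// ltr_wpDr ?sqr_ge0// exprn_gt0.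
  have e1 : e != 0 by rewrite gt_eqF.
  rewrite /poisson; move: pi0; generalize (pi : R) => p p0.
  rewrite (_ : 1 + ((s - t) / e) ^+ 2 = (e ^+ 2 + (t - s) ^+ 2) / e ^+ 2); last by field.
  by field; rewrite e1 D2 p0.
rewrite mulrBr; apply: (Rintegral_is_derive ab dF) => s.
apply: (@continuous_comp R R R (fun s => t - s) (poisson e)).
  by apply: cvgB; [exact: cvg_cst|exact: cvg_id].
exact: continuous_poisson.
Qed.

Lemma cvg_atan_pos (x : R) : 0 < x -> atan (x / harmonic n) @[n --> \oo] --> (pi / 2 : R).
Proof.
move=> x0; apply: (cvg_comp _ _ _ (@cvgy_atan R)).
under eq_fun do rewrite /harmonic invrK.
have c1 : (n.+1%:R : R) @[n --> \oo] --> +oo.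
  by rewrite (cvg_shiftS (fun n => n%:R : R)); exact: cvgr_idn.
apply: (cvg_comp _ (fun y => x * y) c1).
by apply: gt0_cvgMry => //; exact: cvg_id.
Qed.

Lemma cvg_atan_neg (x : R) : x < 0 -> atan (x / harmonic n) @[n --> \oo] --> (- (pi / 2) : R).
Proof.
move=> x0; rewrite (_ : (fun n => _) = fun n => - atan (- x / harmonic n)).
  by apply: cvgN; apply: cvg_atan_pos; rewrite oppr_gt0.
by apply/funext => n; rewrite mulNr atanN opprK.
Qed.

(* The integral of the Poisson kernel centered at [t] over [a, b], see
   [Rintegral_poisson]: a smoothed indicator function. *)
Definition box (a b e t : R) := pi^-1 * (atan ((b - t) / e) - atan ((a - t) / e)).

Lemma norm_box_le (a b e t : R) : `|box a b e t| <= 1.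
Proof.
rewrite /box normrM gtr0_norm ?invr_gt0 ?pi_gt0// ler_pdivrMl ?pi_gt0// mulr1.
have := atan_gtNpi2 ((b - t) / e); have := atan_ltpi2 ((b - t) / e).
have := atan_gtNpi2 ((a - t) / e); have := atan_ltpi2 ((a - t) / e).
by rewrite ler_norml; lra.
Qed.

Lemma measurable_box (a b e : R) : measurable_fun setT (box a b e).
Proof.
have mA : measurable_fun setT (@atan R).
  by apply: continuous_measurable_fun => x; exact: continuous_atan.
apply: measurable_funM => //; apply: measurable_funB; apply: (measurableT_comp mA);
  by apply: measurable_funM => //; exact: measurable_funB.
Qed.

(** At either endpoint one arctangent vanishes and the limit is 1/2; these two points form a null
    set. *)
Lemma cvg_box (a b t : R) : a < b -> t != a -> t != b ->
  box a b (harmonic n) t @[n --> \oo] --> (\1_`[a, b] t : R).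
Proof.
move=> ab ta tb.
have H l m : atan ((b - t) / harmonic n) @[n --> \oo] --> (l : R) ->
   atan ((a - t) / harmonic n) @[n --> \oo] --> (m : R) -> pi^-1 * (l - m) = \1_`[a, b] t ->
   box a b (harmonic n) t @[n --> \oo] --> (\1_`[a, b] t : R).
  by move=> cl cm <-; apply: cvgM; [exact: cvg_cst|exact: cvgB].
have [{}ta|{}ta|/eqP] := ltgtP t a; last by rewrite (negbTE ta).
  apply: (H _ _ (cvg_atan_pos _) (cvg_atan_pos _)); rewrite ?subr_gt0//.
    by rewrite (lt_trans ta).
  by rewrite indicE memNset ?subrr ?mulr0//= in_itv/= leNgt ta.
have [{}tb|{}tb|/eqP] := ltgtP t b; last by rewrite (negbTE tb).
  apply: (H _ _ (cvg_atan_pos _) (cvg_atan_neg _)); rewrite ?subr_gt0 ?subr_lt0//.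
  rewrite indicE mem_set/= ?in_itv/= ?(ltW ta) ?(ltW tb)//.
  by rewrite opprK -splitr mulVf.
apply: (H _ _ (cvg_atan_neg _) (cvg_atan_neg _)); rewrite ?subr_lt0//.
rewrite indicE memNset ?subrr ?mulr0//= in_itv/= => /andP[_].
by rewrite leNgt tb.
Qed.

Lemma ae_neq2 (a b : R) : {ae mu, forall t : R, t != a /\ t != b}.
Proof.
exists [set a; b]; split.
- by apply: measurableU; exact: measurable_set1.
- by apply: countable_lebesgue_measure0; apply: finite_set_countable; exact: finite_set2.
- move=> t /= /not_andP[] /negP; rewrite negbK => /eqP ->; by [left|right].
Qed.

Lemma aeS (P Q : R -> Prop) : (forall x, P x -> Q x) ->
  {ae mu, forall x, P x} -> {ae mu, forall x, Q x}.
Proof.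
move=> PQ; apply: filterS; first exact: (ae_filter_ringOfSetsType mu).
exact: PQ.
Qed.

Lemma aeI (P Q : R -> Prop) : {ae mu, forall x, P x} -> {ae mu, forall x, Q x} ->
  {ae mu, forall x, P x /\ Q x}.
Proof. by move=> aP aQ; exact: (@filterI _ _ (ae_filter_ringOfSetsType mu) _ _ aP aQ). Qed.

(** Dominated convergence with majorant [|k|], as boxes are bounded by 1. *)
Lemma Rintegral_itv_box (k : R -> R) (a b : R) : a < b -> rint k ->
  (forall n, \int[mu]_t (k t * box a b (harmonic n) t) = 0) ->
  \int[mu]_(t in `[a, b]) k t = 0.
Proof.
move=> ab ik kb; have mk := rint_measurable ik.
have mkb n : measurable_fun setT (fun t => k t * box a b (harmonic n) t).
  by apply: measurable_funM => //; exact: measurable_box.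
have [] := @dominated_convergence _ _ R mu setT measurableT
  (fun n t => (k t * box a b (harmonic n) t)%:E) (fun t => (k t * \1_`[a, b] t)%:E)
  (fun t => `|k t|%:E).
- by move=> n; apply/measurable_EFinP; exact: mkb.
- by apply/measurable_EFinP; apply: measurable_funM => //; exact: measurable_indic.
- apply: aeS (ae_neq2 a b) => t [ta tb] _; apply: cvg_EFin; first exact: nearW.
  by apply: cvgM; [exact: cvg_cst|exact: cvg_box].
- exact: rint_norm.
- apply: aeW => t n _; rewrite /= lee_fin normrM ler_piMr//; exact: norm_box_le.
move=> _ _; rewrite [X in X @ _ --> _](_ : _ = cst 0%E); last first.
  apply/funext => n /=; rewrite rint_fine ?kb//.
  apply: (rint_le (mkb n) (rint_norm ik)) => t.
  by rewrite normrM ler_piMr//; exact: norm_box_le.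
move=> /(cvg_unique (@ereal_hausdorff R) (cvg_cst _)) E.
rewrite Rintegral_mkcond /Rintegral; rewrite -[RHS]/(fine 0%E) [in RHS]E; congr fine.
by apply: eq_integral => t _; rewrite patch_indic.
Qed.

(** * Lebesgue differentiation along shrinking symmetric intervals *)

Section interval_averages.
Variable d : nat -> R.
Hypotheses (d_gt0 : forall n, 0 < d n) (d_cvg0 : d n @[n --> \oo] --> (0 : R)).

Lemma nice_itv (x : R) : nicely_shrinking x (fun n => `[x - d n, x + d n]%classic).
Proof.
split; first by [].
have d2 n : 0 < 2 * d n by rewrite mulr_gt0.
(* The open ball of radius [2 * d n] contains the closed interval and has exactly twice its
   measure. *)
exists (2, fun n => PosNum (d2 n)); split=> //=.
- by rewrite -(mulr0 2); apply: cvgM; [exact: cvg_cst|exact: d_cvg0].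
- move=> n t; rewrite /ball/= in_itv/= => /andP[h1 h2].
  by have := d_gt0 n; rewrite ltr_norml => d0; apply/andP; split; lra.
- move=> n; have d0 := d_gt0 n.
  rewrite lebesgue_measure_ball; last by rewrite ltW.
  have dd : x - d n < x + d n by lra.
  rewrite lebesgue_measure_itv/= lte_fin dd -EFinD -EFinM lee_fin.
  by rewrite -mulr_natl; lra.
Qed.

Lemma ae_cvg_avg (h : R -> R) : rint h ->
  {ae mu, forall x : R, (2 * d n)^-1 *
     (\int[mu]_(y in `[x - d n, x + d n]) h y) @[n --> \oo] --> h x}.
Proof.
move=> ih; have lh := open_integrable_locally openT ih.
apply: aeS (lebesgue_differentiation lh) => x /(nice_lebesgue_differentiation nice_itv lh).
rewrite (_ : (fun n => _) = EFin \o (fun n => (2 * d n)^-1 *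
     (\int[mu]_(y in `[x - d n, x + d n]) h y))); first by move/fine_cvgP => [_].
apply/funext => n /=; have d0 := d_gt0 n.
have dd : x - d n < x + d n by lra.
rewrite lebesgue_measure_itv/= lte_fin dd -EFinD EFinM /Rintegral fineK; last first.
  by apply: integrable_fin_num => //; apply: integrableS ih.
have -> : x + d n - (x - d n) = 2 * d n by ring.
by rewrite inver gt_eqF// mulr_gt0.
Qed.

End interval_averages.

Lemma ae_eq0_box (h : R -> R) : rint h ->
  (forall a b : R, a < b -> \int[mu]_(y in `[a, b]) h y = 0) -> {ae mu, forall x : R, h x = 0}.
Proof.
move=> ih h0; apply: aeS (ae_cvg_avg (@harmonic_gt0 R) (@cvg_harmonic R) ih) => x.
rewrite (_ : (fun n => _) = cst 0).
  by move=> /(cvg_unique (@Rhausdorff R) (cvg_cst _)).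
apply/funext => n; rewrite h0 ?mulr0//.
by rewrite ltrD2l gtrN// harmonic_gt0.
Qed.

Lemma rint_indic_itv (a b : R) : rint (\1_`[a, b] : R -> R).
Proof.
apply/integrableP; split.
  by apply/measurable_EFinP; exact: measurable_indic.
under eq_integral do rewrite gee0_abs ?lee_fin//.
by rewrite integral_indic// setIT [X in (X < _)%E]lebesgue_measure_itv/=; case: ifP => _; rewrite ltry.
Qed.

(** Uniqueness is first stated on intervals because Plancherel compares averages of
    autocorrelations; [ft_eq0_ae] follows from it by differentiation. *)
Lemma ft_eq0_itv (K : R -> R[i]) : L1 K -> (forall x, ft K x = 0) ->
  forall a b : R, a < b -> cint `[a, b] K = 0.
Proof.
move=> LK K0 a b ab.
have Kp (e s : R) : 0 < e -> cint setT (fun t => K t * (poisson e (t - s))%:C%C) = 0.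
  move=> e0; have La := L1_real (rint_abel e0).
  (* Modulation of the Abel factor recenters its transform, the Poisson kernel, at [s]. *)
  have Lw : L1 (fun x => (abel e x)%:C%C * cis (x * - s)) by exact: L1_cis.
  have := ft_mult LK Lw.
  rewrite (_ : (fun x => _) = fun=> 0); last by apply/funext => x; rewrite K0 mul0r.
  rewrite (_ : cint setT (fun=> 0) = 0); last first.
    by rewrite /cint /Rintegral /= integral0.
  move=> ->; apply: eq_cint => t _; congr (_ * _).
  rewrite -ft_abel//; apply: eq_cint => x _.
  by rewrite -mulrA -cisD; congr (_ * cis _); ring.
(* Integrating the center [s] over [[a, b]] turns Poisson kernels into [box]. *)
pose I := fun s : R => (\1_`[a, b] s : R)%:C%C.
have LI : L1 I by apply: L1_real; exact: rint_indic_itv.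
have Kb (e : R) : 0 < e -> cint setT (fun t => K t * (box a b e t)%:C%C) = 0.
  move=> e0.
  have mk : cmf (fun z : R * R => (poisson e (z.2 - z.1))%:C%C).
    apply: cmf_real; apply: (measurableT_comp (f := poisson e)).
      by apply: continuous_measurable_fun; exact: continuous_poisson.
    exact: measurable_funB.
  have kC (x y : R) : normc (poisson e (y - x))%:C%C <= e / (pi * e ^+ 2).
    by rewrite normcR ger0_norm ?poisson_ge0// poisson_le.
  have [_ _] := cint_Fubini_bounded LK LI mk kC.
  rewrite (_ : (fun x => _) = fun=> 0); last by apply/funext => x; rewrite Kp// mulr0.
  rewrite (_ : cint setT (fun=> 0) = 0); last first.
    by rewrite /cint /Rintegral /= integral0.
  move=> ->; apply: eq_cint => t _; congr (_ * _).
  rewrite /box -Rintegral_poisson// Rintegral_mkcond -cint_real.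
  apply: eq_cint => s _.
  by rewrite patch_indic rmorphM/= mulrC.
have [iK1 iK2] := LK; apply: complex_ext => /=; apply: Rintegral_itv_box => // n.
  have := congr1 (@Re R) (Kb _ (@harmonic_gt0 R n)) => /= <-.
  by apply: eq_Rintegral => t _; rewrite ReM/= mulr0 subr0.
have := congr1 (@Im R) (Kb _ (@harmonic_gt0 R n)) => /= <-.
by apply: eq_Rintegral => t _; rewrite ImM/= mulr0 add0r.
Qed.

Lemma ft_eq0_ae (K : R -> R[i]) : L1 K -> (forall x, ft K x = 0) ->
  {ae mu, forall x : R, K x = 0}.
Proof.
move=> LK K0; have [K1 K2] := LK; have KI := ft_eq0_itv LK K0.
have a1 := ae_eq0_box K1 (fun a b ab => congr1 (@Re R) (KI a b ab)).
have a2 := ae_eq0_box K2 (fun a b ab => congr1 (@Im R) (KI a b ab)).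
by apply: aeS (aeI a1 a2) => x [x1 x2]; exact: complex_ext.
Qed.

End uniqueness.

(** * Plancherel equality *)

Section plancherel.
Variable R : realType.
Local Notation mu := (@lebesgue_measure R).

(** Integrability of the limit is part of the conclusion: this is how [ft F] is found to be square
    integrable. *)
Lemma rint_fatou (g : nat -> R -> R) (h : R -> R) (M : R) :
  (forall n, rint (g n)) -> (forall n x, 0 <= g n x) -> measurable_fun setT h ->
  (forall x, 0 <= h x) ->
  {ae mu, forall x : R, g n x @[n --> \oo] --> h x} ->
  (forall n, \int[mu]_x g n x <= M) ->
  rint h /\ \int[mu]_x h x <= M.
Proof.
move=> ig g0 mh h0 gh gM.
have mg n : measurable_fun setT (EFin \o g n).
  by apply/measurable_EFinP; exact: rint_measurable.
have mh' : measurable_fun setT (EFin \o h) by exact/measurable_EFinP.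
suff H : (\int[mu]_x (h x)%:E <= M%:E)%E.
  have ih : rint h.
    apply/integrableP; split => //.
    under eq_integral do rewrite gee0_abs ?lee_fin//.
    by rewrite (le_lt_trans H)// ltry.
  by split=> //; rewrite -lee_fin -rint_fine.
have -> : (\int[mu]_x (h x)%:E = \int[mu]_x limn_einf (fun n => (g n x)%:E))%E.
  apply: ae_eq_integral => //.
    rewrite (_ : (fun x => _) = fun x => (- limn_esup (fun n => - (g n x)%:E))%E).
      apply: measurableT_comp => //; apply: measurable_fun_limn_esup => n.
      by apply: measurableT_comp => //; exact: mg.
    apply/funext => x; rewrite -limn_einfN; congr limn_einf.
    by apply/funext => n /=; rewrite opprK.
  apply: aeS gh => x gh _; apply/esym.
  have cg : (g n x)%:E @[n --> \oo] --> (h x)%:E by apply: cvg_EFin; [exact: nearW|exact: gh].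
  by have [] := cvg_limn_einf_sup cg.
apply: (le_trans (fatou _ _ _ _)) => //.
- by move=> n x _; rewrite lee_fin.
rewrite limn_einf_lim; apply: lime_le.
  exact: is_cvg_einfs.
apply: nearW => n.
apply: (@le_trans _ _ (\int[mu]_x (g n x)%:E)%E).
  by apply: ereal_inf_lbound; exists n => /=.
by rewrite rint_fine// lee_fin.
Qed.

Lemma Rintegral_reflect_itv (h : R -> R) (t d : R) : rint h ->
  \int[mu]_(y in `[- d, d]) h (t - y) = \int[mu]_(s in `[t - d, t + d]) h s.
Proof.
move=> ih; rewrite [LHS]Rintegral_mkcond [RHS]Rintegral_mkcond.
have ik : rint (h \_ `[t - d, t + d]).
  rewrite /rint -restrict_EFin; apply/integrable_restrict => //.
  by rewrite setTI; apply: integrableS ih.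
have [_ <-] := rint_reflect t ik.
apply: eq_Rintegral => y _; rewrite !patchE.
have -> : (t - y \in `[t - d, t + d]%classic) = (y \in `[- d, d]%classic) => //.
by apply/idP/idP; rewrite !inE/= !in_itv/=; lra.
Qed.

Lemma rint_itv (h : R -> R) (a b : R) : rint h ->
  mu.-integrable `[a, b] (EFin \o h).
Proof. by move=> ih; apply: integrableS ih. Qed.

Lemma integrable_cst_itv (a b c : R) : mu.-integrable `[a, b] (EFin \o fun=> c).
Proof.
apply: continuous_compact_integrable; first exact: segment_compact.
by apply: continuous_subspaceT => x; exact: cst_continuous.
Qed.

Lemma Rintegral_indicM (h : R -> R) (a b : R) :
  \int[mu]_y (\1_`[a, b] y * h y) = \int[mu]_(y in `[a, b]) h y.
Proof.
rewrite [RHS]Rintegral_mkcond; apply: eq_Rintegral => y _.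
by rewrite patch_indic mulrC.
Qed.

(** Meant for the real parts of two autocorrelations: their averages agree, and the pointwise bound
    is available on the side of [q]. *)
Lemma avg_le (p q : R -> R) (N d : R) : 0 < d -> rint p -> rint q ->
  \int[mu]_(y in `[- d, d]) (p y - q y) = 0 -> (forall y, q y <= N) ->
  (2 * d)^-1 * \int[mu]_(y in `[- d, d]) p y <= N.
Proof.
move=> d0 ip iq + qN.
have dd : - d < d by rewrite gtrN.
rewrite RintegralB//; [|exact: rint_itv..].
move=> /eqP; rewrite subr_eq0 => /eqP ->.
rewrite ler_pdivrMl ?mulr_gt0//.
have -> : 2 * d * N = \int[mu]_(y in `[- d, d]) N.
  rewrite Rintegral_cst// [X in fine X]lebesgue_measure_itv/= lte_fin dd.
  by rewrite -EFinD/=; ring.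
by apply: le_Rintegral => //; [exact: rint_itv|exact: integrable_cst_itv].
Qed.

(** Written as a convolution so that [conv_ft] computes its transform; [0 - s] is the shape handled
    by [cint_reflect]. *)
Definition autocorr (u : R -> R[i]) := conv u (fun s => conjc (u (0 - s))).

Lemma autocorrE u y : autocorr u y = cint setT (fun t => u t * conjc (u (t - y))).
Proof. by apply: eq_cint => t _; rewrite sub0r opprB. Qed.

Section autocorrelation.
Variable u : R -> R[i].
Hypotheses (L1u : L1 u) (L2u : L2 u).
Let N := \int[mu]_t (normc (u t) ^+ 2).

Let L1c : L1 (fun s => conjc (u (0 - s))).
Proof. exact: (cint_reflect 0 (L1J L1u)).1. Qed.

Let L2c : L2 (fun s => conjc (u (0 - s))).
Proof. exact: (L2_reflect 0 (L2_conj L2u)). Qed.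

Lemma L1_autocorr : L1 (autocorr u).
Proof. exact: (conv_ft L1u L2u L1c L2c).1. Qed.

Lemma ft_autocorr x : ft (autocorr u) x = (normc (ft u x) ^+ 2)%:C%C.
Proof. by rewrite (conv_ft L1u L2u L1c L2c).2 ft_conj_reflect// mulcJ. Qed.

Let L1uu y : L1 (fun t => u t * conjc (u (t - y))).
Proof. by apply: L2_L1M => //; apply: L2_conj; exact: L2_shift. Qed.

Let iN : rint (fun t => normc (u t) ^+ 2). Proof. by case: L2u => _ []. Qed.

(** A crude bound, the 2 being that of [normc_cint_le]. It serves for majorants; the sharp estimate
    is [Re_autocorr_le]. *)
Lemma normc_autocorr_le y : normc (autocorr u y) <= 2 * N.
Proof.
have [iNs eNs] := rint_shift y iN.
rewrite autocorrE.
have ih := rintZ 2^-1 (rintD iN iNs).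
apply: (le_trans (normc_cint_le (L1uu y) ih _)).
  move=> t; rewrite ComplexField.Normc.normcM normc_conjc.
  by have := sqr_ge0 (normc (u t) - normc (u (t - y))); nra.
rewrite RintegralZl//; last exact: rintD.
by rewrite RintegralD// eNs -/N ler_pM2l//; lra.
Qed.

(** Polarization expresses the autocorrelation through a nonnegative integrand, to which Fatou can
    be applied. *)
Lemma Re_autocorr y : \int[mu]_t (2^-1 * normc (u t + u (t - y)) ^+ 2) = N + Re (autocorr u y).
Proof.
have [iNs eNs] := rint_shift y iN.
rewrite autocorrE -[Re _]/(\int[mu]_t (Re (u t * conjc (u (t - y))))).
have iR := (L1uu y).1.
transitivity (\int[mu]_t (2^-1 * (normc (u t) ^+ 2 + normc (u (t - y)) ^+ 2) +
   Re (u t * conjc (u (t - y))))).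
  by apply: eq_Rintegral => t _; rewrite !sqr_normcE !ReImE; field.
rewrite RintegralD//; last by apply: rintZ; exact: rintD.
rewrite RintegralZl//; last exact: rintD.
by rewrite RintegralD// eNs -/N; congr (_ + _); field.
Qed.

Let Q t y := 2^-1 * normc (u t + u (t - y)) ^+ 2.

(** For fixed [t] this is linear in [|u|^2], [Re u] and [Im u] at [t - y], so averages in [y] reduce
    to those of three integrable functions. *)
Let QE t y : Q t y = 2^-1 * normc (u t) ^+ 2 + 2^-1 * normc (u (t - y)) ^+ 2 +
  (Re (u t) * Re (u (t - y)) + Im (u t) * Im (u (t - y))).
Proof. by rewrite /Q !sqr_normcE !ReImE; field. Qed.

Let Q_ge0 t y : 0 <= Q t y. Proof. by rewrite mulr_ge0// sqr_ge0. Qed.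

Let mQ : measurable_fun setT (fun z : R * R => Q z.2 z.1).
Proof.
apply: measurable_funM => //; apply: measurable_funX; apply: measurable_normc.
have mu' := L1_cmf L1u; apply: cmfD; first exact: cmf_snd.
apply: (cmf_comp (h := fun z : R * R => z.2 - z.1)) => //.
exact: measurable_funB.
Qed.

Let rintQ2 y : rint (Q^~ y).
Proof.
have [iNs _] := rint_shift y iN.
apply: (rint_le _ (rintD iN iNs)).
  exact: (measurableT_comp mQ (measurable_pair1 y)).
move=> t; rewrite ger0_norm// QE !sqr_normcE.
have := sqr_ge0 (Re (u t) - Re (u (t - y))); have := sqr_ge0 (Im (u t) - Im (u (t - y))).
nra.
Qed.

(** Integrate the parallelogram bound of [Q t y] by [|u t|^2 + |u (t - y)|^2]. The constant 1 is
    essential: it becomes the constant of the Plancherel inequality. *)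
Lemma Re_autocorr_le y : Re (autocorr u y) <= N.
Proof.
have [iNs eNs] := rint_shift y iN.
rewrite -(lerD2l N) -Re_autocorr {2}/N -eNs -RintegralD//.
apply: le_Rintegral => //; [exact: rintQ2|exact: rintD|] => t _.
rewrite -/(Q t y) QE !sqr_normcE.
have := sqr_ge0 (Re (u t) - Re (u (t - y))); have := sqr_ge0 (Im (u t) - Im (u (t - y))).
nra.
Qed.

Let rintIQ (d t : R) : rint (fun y => \1_`[- d, d] y * Q t y).
Proof.
have [i1 _] := rint_reflect t iN.
apply: (rint_le _ (rintD (rintZ (normc (u t) ^+ 2) (rint_indic_itv (- d) d)) i1)).
  apply: measurable_funM; first exact: measurable_indic.
  exact: (measurableT_comp mQ (measurable_pair2 t)).
move=> y; rewrite indicE; case: (y \in _) => /=; last first.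
  by rewrite mul0r mulr0 add0r normr0 sqr_ge0.
rewrite mul1r mulr1 ger0_norm// QE !sqr_normcE.
have := sqr_ge0 (Re (u t) - Re (u (t - y))); have := sqr_ge0 (Im (u t) - Im (u (t - y))).
nra.
Qed.

Let Fub (d : R) : 0 < d ->
  rint (fun t => \int[mu]_y (\1_`[- d, d] y * Q t y)) /\
  \int[mu]_t (\int[mu]_y (\1_`[- d, d] y * Q t y)) =
    2 * d * N + \int[mu]_(y in `[- d, d]) Re (autocorr u y).
Proof.
move=> d0.
have IQ y : \int[mu]_t (\1_`[- d, d] y * Q t y) = \1_`[- d, d] y * (N + Re (autocorr u y)).
  by rewrite -Re_autocorr -RintegralZl//; exact: rintQ2.
(* The factor 3 bounds [N + Re (autocorr u y)] by means of [normc_autocorr_le]. *)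
have [] := @rint_Fubini R (fun y t => \1_`[- d, d] y * Q t y) (fun y => (3 * N) * \1_`[- d, d] y).
- have mI : measurable_fun setT (\1_`[- d, d] : R -> R) by exact: measurable_indic.
  by apply: measurable_funM; [exact: (measurableT_comp mI measurable_fst)|exact: mQ].
- by move=> y; apply: rintZ; exact: rintQ2.
- by move=> t; exact: rintIQ.
- by apply: rintZ; exact: rint_indic_itv.
- move=> y; rewrite (_ : \int[mu]_t _ = \int[mu]_t (\1_`[- d, d] y * Q t y)); last first.
    by apply: eq_Rintegral => t _; rewrite ger0_norm// mulr_ge0// indicE ler0n.
  rewrite IQ mulrC ler_wpM2r ?indicE ?ler0n//.
  have := le_trans (normRe_le _) (normc_autocorr_le y).
  by rewrite ler_norml => /andP[_]; lra.
move=> _ i2; under [X in X = _ -> _]eq_Rintegral do rewrite IQ.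
move=> <-; split => //; rewrite Rintegral_indicM RintegralD//.
- rewrite Rintegral_cst// [X in fine X]lebesgue_measure_itv/= lte_fin gtrN//.
  by rewrite -EFinD/=; ring.
- exact: integrable_cst_itv.
- by apply: rint_itv; exact: (L1_autocorr).1.
Qed.

Variable d : nat -> R.
Hypotheses (d_gt0 : forall n, 0 < d n) (d_cvg0 : d n @[n --> \oo] --> (0 : R)).

(* The average over [|y| <= d n] of [|u t + u (t - y)|^2 / 2] tends to [2 |u t|^2] at
   every Lebesgue point [t], and its integral in [t] is [N] plus the average of the
   autocorrelation; Fatou gives [2 N <= N + M]. *)
Lemma sqr_norm_le_avg_autocorr (M : R) :
  (forall n, (2 * d n)^-1 * \int[mu]_(y in `[- d n, d n]) Re (autocorr u y) <= M) -> N <= M.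
Proof.
move=> avgM; have [iu1 iu2] := L1u.
pose g n t := (2 * d n)^-1 * \int[mu]_y (\1_`[- d n, d n] y * Q t y).
have [] := @rint_fatou g (fun t => 2 * normc (u t) ^+ 2) (N + M).
- by move=> n; apply: rintZ; exact: (Fub (d_gt0 n)).1.
- move=> n t; rewrite mulr_ge0 ?invr_ge0 ?mulr_ge0 ?(ltW (d_gt0 n))//.
  by apply: Rintegral_ge0 => y _; rewrite mulr_ge0.
- by apply: measurable_funM => //; exact: rint_measurable iN.
- by move=> t; rewrite mulr_ge0// sqr_ge0.
(* By [QE], averages must converge at [t] for [|u|^2], [Re u] and [Im u] simultaneously. *)
- have aN := ae_cvg_avg d_gt0 d_cvg0 iN.
  have a1 := ae_cvg_avg d_gt0 d_cvg0 iu1; have a2 := ae_cvg_avg d_gt0 d_cvg0 iu2.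
  apply: aeS (aeI aN (aeI a1 a2)) => t [cN [c1 c2]].
  pose A (h : R -> R) n := (2 * d n)^-1 * \int[mu]_(y in `[t - d n, t + d n]) h y.
  have gE n : g n t = 2^-1 * normc (u t) ^+ 2 + 2^-1 * A (fun t => normc (u t) ^+ 2) n +
      (Re (u t) * A (fun t => Re (u t)) n + Im (u t) * A (fun t => Im (u t)) n).
    rewrite /g Rintegral_indicM.
    under eq_Rintegral do rewrite QE.
    have r1 := rint_itv (- d n) (d n) (rint_reflect t iN).1.
    have r2 := rint_itv (- d n) (d n) (rint_reflect t iu1).1.
    have r3 := rint_itv (- d n) (d n) (rint_reflect t iu2).1.
    have rZ (c : R) (h : R -> R) : mu.-integrable `[- d n, d n] (EFin \o h) ->
        mu.-integrable `[- d n, d n] (EFin \o (fun y => c * h y)).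
      by move=> ih; exact: (integrableZl _ c ih).
    have rD (h k : R -> R) : mu.-integrable `[- d n, d n] (EFin \o h) ->
        mu.-integrable `[- d n, d n] (EFin \o k) ->
        mu.-integrable `[- d n, d n] (EFin \o (fun y => h y + k y)).
      by move=> ih ik; exact: (integrableD _ ih ik).
    have rc (c : R) : mu.-integrable `[- d n, d n] (EFin \o (fun=> c)).
      exact: integrable_cst_itv.
    rewrite RintegralD//; [|by apply: rD => //; apply: rZ|by apply: rD; apply: rZ].
    rewrite RintegralD//; [|exact: rZ].
    rewrite RintegralD//; [|exact: rZ..].
    have e1 : \int[mu]_(y in `[- d n, d n]) (normc (u (t - y)) ^+ 2) = _ :=
      Rintegral_reflect_itv t (d n) iN.
    have e2 : \int[mu]_(y in `[- d n, d n]) Re (u (t - y)) = _ :=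
      Rintegral_reflect_itv t (d n) iu1.
    have e3 : \int[mu]_(y in `[- d n, d n]) Im (u (t - y)) = _ :=
      Rintegral_reflect_itv t (d n) iu2.
    rewrite !RintegralZl// e1 e2 e3.
    rewrite Rintegral_cst// [X in fine X]lebesgue_measure_itv/= lte_fin gtrN//.
    rewrite -EFinD/= /A; field.
    by rewrite gt_eqF.
  rewrite (funext gE : (fun n => g n t) = _).
  have -> : 2 * normc (u t) ^+ 2 = 2^-1 * normc (u t) ^+ 2 + 2^-1 * normc (u t) ^+ 2 +
      (Re (u t) * Re (u t) + Im (u t) * Im (u t)).
    by rewrite -!expr2 -sqr_normcE; field.
  apply: cvgD; last by apply: cvgD; apply: cvgM => //; exact: cvg_cst.
  by apply: cvgD; [exact: cvg_cst|apply: cvgM => //; exact: cvg_cst].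
- move=> n; rewrite RintegralZl; [|by []|exact: (Fub (d_gt0 n)).1].
  rewrite (Fub (d_gt0 n)).2 mulrDr mulrA mulVf ?gt_eqF ?mulr_gt0//.
  by rewrite mul1r lerD2l.
by move=> _; rewrite RintegralZl// -/N; lra.
Qed.

End autocorrelation.

(** Equal [|ft|] means equal transforms of the autocorrelations, hence equal averages. Those of [v]
    are at most its squared norm, and that of [u] is at most any bound on the averages. *)
Lemma eq_norm_ft_le (u v : R -> R[i]) : L1 u -> L2 u -> L1 v -> L2 v ->
  (forall x, normc (ft u x) = normc (ft v x)) ->
  \int[mu]_t (normc (u t) ^+ 2) <= \int[mu]_t (normc (v t) ^+ 2).
Proof.
move=> Lu L2u Lv L2v uv.
apply: (sqr_norm_le_avg_autocorr Lu L2u (@harmonic_gt0 R) (@cvg_harmonic R)) => n.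
have := @harmonic_gt0 R n; move: (harmonic n) => d d0.
have Lau := L1_autocorr Lu L2u; have Lav := L1_autocorr Lv L2v.
have dd : - d < d by rewrite gtrN.
have f0 x : ft (fun t => autocorr u t - autocorr v t) x = 0.
  by rewrite ftB// !ft_autocorr// uv subrr.
apply: (@avg_le (fun y => Re (autocorr u y)) (fun y => Re (autocorr v y)) _ _ d0 Lau.1 Lav.1).
  transitivity (Re (cint `[- d, d] (fun y => autocorr u y - autocorr v y))).
    by apply: eq_Rintegral => y _; rewrite ReD ReN.
  by rewrite (ft_eq0_itv (L1B Lau Lav) f0 dd).
by move=> y; exact: Re_autocorr_le.
Qed.

Lemma eq_norm_ft (u v : R -> R[i]) : L1 u -> L2 u -> L1 v -> L2 v ->
  (forall x, normc (ft u x) = normc (ft v x)) ->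
  \int[mu]_t (normc (u t) ^+ 2) = \int[mu]_t (normc (v t) ^+ 2).
Proof.
by move=> Lu L2u Lv L2v uv; apply: le_anti; rewrite !eq_norm_ft_le.
Qed.

Lemma conv_supp (u v : R -> R[i]) (B y : R) :
  (forall t, B < `|t| -> u t = 0) -> (forall t, B < `|t| -> v t = 0) ->
  2 * B < `|y| -> conv u v y = 0.
Proof.
move=> u0 v0 By; rewrite /conv (@eq_cint _ _ _ (fun=> 0)).
  by rewrite /cint /Rintegral /= integral0.
move=> t _; have [tB|] := ltP B `|t|; first by rewrite u0 ?mul0r.
move=> tB; rewrite v0 ?mulr0//.
have := ler_normD (y - t) t; rewrite subrK; lra.
Qed.

(* [|ft F|^2] is the transform of the autocorrelation of [F], which is bounded and
   supported in [-2B, 2B]; its Abel means are thus controlled by the mass of the Poisson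
   kernel. *)
Lemma L2_ft (F : R -> R[i]) (B : R) : 0 < B -> L1 F -> L2 F ->
  (forall t, B < `|t| -> F t = 0) -> L2 (ft F).
Proof.
move=> B0 LF L2F F0.
have [m1 m2] := cmf_ft LF; split; [exact: m1|split; first exact: m2].
pose r := autocorr F; have Lr : L1 r by exact: L1_autocorr.
have r0 y : 2 * B < `|y| -> r y = 0.
  by apply: conv_supp => // t tB; rewrite sub0r F0 ?normrN// conjc0.
pose N := \int[mu]_t (normc (F t) ^+ 2).
have N0 : 0 <= N by apply: Rintegral_ge0 => t _; exact: sqr_ge0.
pose e n := @harmonic R n.
have e0 n : 0 < e n by exact: harmonic_gt0.
have mn2 : measurable_fun setT (fun x => normc (ft F x) ^+ 2).
  by apply: measurable_funX; apply: measurable_normc; exact: cmf_ft.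
have ig n : rint (fun x => normc (ft F x) ^+ 2 * abel (e n) x).
  apply: (rint_le _ (rintZ ((2 * \int[mu]_t normc (F t)) ^+ 2) (rint_abel (e0 n)))).
    by apply: measurable_funM => //; exact: rint_measurable (rint_abel (e0 n)).
  move=> x; rewrite ger0_norm; last by rewrite mulr_ge0 ?sqr_ge0// expR_ge0.
  rewrite ler_wpM2r ?expR_ge0// ler_pXn2r// ?nnegrE ?normc_ge0 ?normc_ft_le//.
  by rewrite mulr_ge0// Rintegral_ge0// => t _; exact: normc_ge0.
(* In [4 * N] one factor 2 comes from [normc_autocorr_le], the other from [normc_cint_le]; what
   matters is independence of [n]. *)
have [] // := @rint_fatou (fun n x => normc (ft F x) ^+ 2 * abel (e n) x)
    (fun x => normc (ft F x) ^+ 2) (4 * N).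
- by move=> n x; rewrite mulr_ge0 ?sqr_ge0// expR_ge0.
- by move=> x; exact: sqr_ge0.
- apply: aeW => x; rewrite -[X in _ --> X]mulr1.
  apply: cvgM; first exact: cvg_cst.
  have c0 : (- (2 * pi * e n) * `|x|) @[n --> \oo] --> (0 : R).
    rewrite -[X in _ --> X](_ : - (2 * pi * 0) * `|x| = 0); last by rewrite mulr0 oppr0 mul0r.
    apply: cvgM; last exact: cvg_cst.
    apply: cvgN; apply: cvgM; first exact: cvg_cst.
    exact: cvg_harmonic.
  by have := cvg_comp _ _ c0 (@continuous_expR R 0); rewrite expR0.
- move=> n.
  have La := L1_real (rint_abel (e0 n)).
  have I0 t : 0 <= (\1_`[- (2 * B), 2 * B] t : R) by rewrite indicE ler0n.
  have ip1 : rint (fun t => \1_`[- (2 * B), 2 * B] t * poisson (e n) t).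
    apply: (rint_le _ (rintZ (e n / (pi * e n ^+ 2)) (rint_indic_itv (- (2 * B)) (2 * B)))).
      apply: measurable_funM; first exact: measurable_indic.
      by apply: continuous_measurable_fun; exact: continuous_poisson.
    move=> t; rewrite ger0_norm; last by rewrite mulr_ge0 ?poisson_ge0.
    by rewrite mulrC ler_wpM2r ?I0//; exact: poisson_le.
  have ip := rintZ (2 * N) ip1.
  have rp t : normc (r t * (poisson (e n) t)%:C%C) <=
      2 * N * (\1_`[- (2 * B), 2 * B] t * poisson (e n) t).
    rewrite ComplexField.Normc.normcM normcR ger0_norm ?poisson_ge0// [leRHS]mulrA.
    rewrite ler_wpM2r ?poisson_ge0//.
    have [tB|tB] := ltP (2 * B) `|t|.
      by rewrite r0// ComplexField.Normc.normc0 !mulr_ge0.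
    rewrite indicE mem_set ?mulr1 ?normc_autocorr_le//=.
    by rewrite in_itv/= -ler_norml.
  have E := ft_mult Lr La.
  have -> : \int[mu]_x (normc (ft F x) ^+ 2 * abel (e n) x) =
      Re (cint setT (fun x => ft r x * (abel (e n) x)%:C%C)).
    by apply: eq_Rintegral => x _; rewrite ft_autocorr// ReM /= mulr0 subr0.
  rewrite E; apply: (le_trans (ler_norm _)); apply: (le_trans (normRe_le _)).
  have -> : cint setT (fun t => r t * ft (fun x => (abel (e n) x)%:C%C) t) =
      cint setT (fun t => r t * (poisson (e n) t)%:C%C).
    by apply: eq_cint => t _; rewrite ft_abel.
  apply: (le_trans (normc_cint_le _ ip rp)).
    apply: (L1M_bounded (C := e n / (pi * e n ^+ 2)) Lr).
      apply: cmf_real; apply: continuous_measurable_fun; exact: continuous_poisson.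
    by move=> t; rewrite normcR ger0_norm ?poisson_ge0// poisson_le.
  rewrite (RintegralZl (2 * N) measurableT ip1) Rintegral_indicM.
  have -> : 4 * N = 2 * (2 * N * 1) by ring.
  rewrite ler_pM2l// ler_wpM2l// ?mulr_ge0//.
  (* The kernel is even, so its mass on the support is a value of [box] at 0, at most 1 for every
     [n]. *)
  rewrite (_ : Rintegral _ _ _ = box (- (2 * B)) (2 * B) (e n) 0).
    by rewrite (le_trans (ler_norm _))// norm_box_le.
  rewrite /box -Rintegral_poisson//; last by have := B0; lra.
  by apply: eq_Rintegral => t _; rewrite /poisson sub0r sqrrN.
Qed.

End plancherel.

(** * Analyticity of band-limited functions *)

Section analytic.
Variable R : realType.
Local Notation mu := (@lebesgue_measure R).

(* [icoef k] is [i ^ k / k!]. *)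
Fixpoint icoef (k : nat) : R[i] :=
  if k is j.+1 then Complex 0 1 * icoef j * (j.+1%:R^-1)%:C%C else 1.

Lemma Re_icoefS k : k.+1%:R * Re (icoef k.+1) = - Im (icoef k).
Proof. by rewrite /= !ReImE /=; field. Qed.

Lemma Im_icoefS k : k.+1%:R * Im (icoef k.+1) = Re (icoef k).
Proof. by rewrite /= !ReImE /=; field. Qed.

(** * Taylor remainders of sine, cosine and compactly supported spectra *)

Lemma is_derive_monomial (c : R) n (x : R) :
  is_derive x (1 : R) (fun t => c * t ^+ n) (n%:R * c * x ^+ n.-1).
Proof.
have := is_deriveZ c (is_deriveX n (is_derive_id x (1 : R))).
rewrite (_ : c \*: _ = fun t => c * t ^+ n); last first.
  by apply/funext => t; rewrite exprfctE.
rewrite (_ : c *: _ = n%:R * c * x ^+ n.-1)//.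
by rewrite /GRing.scale/= mulr1; ring.
Qed.

Lemma is_derive_poly_step (c : nat -> R) n (x : R) :
  is_derive x (1 : R) (fun t => \sum_(k < n.+1) c k * t ^+ k)
    (\sum_(k < n) k.+1%:R * c k.+1 * x ^+ k).
Proof.
elim: n => [|n IH].
  rewrite big_ord0 (_ : (fun t => _) = cst (c 0%N)); first exact: is_derive_cst.
  by apply/funext => t; rewrite big_ord1 expr0 mulr1.
rewrite (_ : (fun t => _) = (fun t => \sum_(k < n.+1) c k * t ^+ k) \+ (fun t => c n.+1 * t ^+ n.+1)).
  rewrite big_ord_recr/=.
  by apply: is_deriveD; exact: (is_derive_monomial _ n.+1).
by apply/funext => t; rewrite [LHS]big_ord_recr.
Qed.

Lemma norm_primitive_le (F f : R -> R) n : F 0 = 0 ->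
  (forall x : R, is_derive x (1 : R) F (f x)) -> continuous f ->
  (forall s, 0 <= s -> `|f s| <= s ^+ n / n`!%:R) ->
  forall s, 0 <= s -> `|F s| <= s ^+ n.+1 / n.+1`!%:R.
Proof.
move=> F0 dF cf fn s; rewrite le_eqVlt => /predU1P[<-|s0].
  by rewrite F0 normr0 expr0n mul0r.
have dX (x : R) : is_derive x (1 : R) (fun t => n.+1`!%:R^-1 * t ^+ n.+1) (x ^+ n / n`!%:R).
  have := is_derive_monomial n.+1`!%:R^-1 n.+1 x.
  rewrite (_ : _ * _ * _ = x ^+ n / n`!%:R)// factS natrM /=.
  by rewrite invfM mulrA mulfV ?pnatr_eq0// mul1r mulrC.
have cX : continuous (fun x : R => x ^+ n / n`!%:R).
  by move=> x; apply: cvgM; [exact: exprn_continuous|exact: cvg_cst].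
(* One-sided form, obtained by integrating the nonnegative function [x ^+ n / n! + g x]; it is
   applied to [f] and to [- f]. *)
have D (g : R -> R) (G : R -> R) : G 0 = 0 -> (forall x : R, is_derive x (1 : R) G (g x)) -> continuous g ->
    (forall s, 0 <= s -> - (s ^+ n / n`!%:R) <= g s) -> - (s ^+ n.+1 / n.+1`!%:R) <= G s.
  move=> G0 dG cg gn.
  have dH (x : R) : is_derive x (1 : R) (fun t => n.+1`!%:R^-1 * t ^+ n.+1 + G t) (x ^+ n / n`!%:R + g x).
    exact: is_deriveD.
  have := Rintegral_is_derive s0 dH.
  rewrite G0 expr0n mulr0 addr0 subr0 => H.
  rewrite -subr_ge0 opprK addrC (mulrC (s ^+ _)) -H.
    apply: Rintegral_ge0 => x /=; rewrite in_itv/= => /andP[x0 _].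
    by have := gn _ x0; lra.
  by move=> x; apply: cvgD; [exact: cX|exact: cg].
rewrite ler_norml; apply/andP; split.
  by apply: (D f) => // x x0; have := fn x x0; rewrite ler_norml => /andP[].
rewrite -[X in X <= _]opprK lerNl.
apply: (D (fun x => - f x) (fun x => - F x)).
- by rewrite F0 oppr0.
- by move=> x; apply: cvgN; exact: cf.
- by move=> x x0; have := fn x x0; rewrite lerN2 ler_norml => /andP[].
Qed.

(** The sign [e] brings both half-lines to [0 <= s], where [norm_primitive_le] works. The two bounds
    are proved together since the remainder of each function is, up to sign, a primitive of that of
    the other. *)
Lemma taylor_cos_sin n (e s : R) : `|e| = 1 -> 0 <= s ->
  `|cos (e * s) - \sum_(k < n) Re (icoef k) * (e * s) ^+ k| <= s ^+ n / n`!%:R /\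
  `|sin (e * s) - \sum_(k < n) Im (icoef k) * (e * s) ^+ k| <= s ^+ n / n`!%:R.
Proof.
move=> e1; elim: n s => [|n IH] s s0.
  rewrite !big_ord0 !subr0 expr0 divr1 !ler_norml cos_geN1 cos_le1 sin_geN1 sin_le1.
  by [].
pose rC (m : nat) (x : R) := cos x - \sum_(k < m) Re (icoef k) * x ^+ k.
pose rS (m : nat) (x : R) := sin x - \sum_(k < m) Im (icoef k) * x ^+ k.
have dC (x : R) : is_derive x (1 : R) (rC n.+1) (- rS n x).
  rewrite (_ : - rS n x = - sin x - \sum_(k < n) k.+1%:R * Re (icoef k.+1) * x ^+ k).
    exact: (is_deriveB (is_derive_cos x) (is_derive_poly_step (fun k => Re (icoef k)) n x)).
  rewrite /rS opprB addrC -sumrN; congr (_ + _); apply: eq_bigr => k _.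
  by rewrite Re_icoefS mulNr opprK.
have dS (x : R) : is_derive x (1 : R) (rS n.+1) (rC n x).
  rewrite (_ : rC n x = cos x - \sum_(k < n) k.+1%:R * Im (icoef k.+1) * x ^+ k).
    exact: (is_deriveB (is_derive_sin x) (is_derive_poly_step (fun k => Im (icoef k)) n x)).
  by congr (_ - _); apply: eq_bigr => k _; rewrite Im_icoefS.
have cP (c : nat -> R) m : continuous (fun x : R => \sum_(k < m) c k * x ^+ k).
  case: m => [|m]; last exact: is_derive_continuous (is_derive_poly_step c m).
  by under eq_fun do rewrite big_ord0; move=> x; exact: cst_continuous.
have cC m : continuous (rC m) by move=> x; apply: cvgB; [exact: continuous_cos|exact: (cP (fun k => Re (icoef k)) m x)].
have cS m : continuous (rS m) by move=> x; apply: cvgB; [exact: continuous_sin|exact: (cP (fun k => Im (icoef k)) m x)].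
have cM (h : R -> R) : continuous h -> continuous (fun x => h (e * x)).
  move=> ch x; apply: (@continuous_comp R R R (fun x => e * x) h); last exact: ch.
  by apply: cvgM; [exact: cvg_cst|exact: cvg_id].
have z c : c 0%N - \sum_(k < n.+1) c k * (e * 0) ^+ k = 0 :> R.
  rewrite big_ord_recl/= expr0 mulr1 big1 ?addr0 ?subrr// => i _.
  by rewrite mulr0 expr0n mulr0.
split.
- apply: (@norm_primitive_le (fun x => rC n.+1 (e * x)) (fun x => e * - rS n (e * x))) => //.
  + by rewrite /rC -[RHS](z (fun k => Re (icoef k))) mulr0 cos0.
  + by move=> x; exact: is_derive_comp_linear.
  + move=> x; apply: cvgM; first exact: cvg_cst.
    by apply: cvgN; exact: cM.
  + by move=> x x0; rewrite normrM e1 mul1r normrN; have [] := IH x x0.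
- apply: (@norm_primitive_le (fun x => rS n.+1 (e * x)) (fun x => e * rC n (e * x))) => //.
  + by rewrite /rS -[RHS](z (fun k => Im (icoef k))) mulr0 sin0.
  + by move=> x; exact: is_derive_comp_linear.
  + by move=> x; apply: cvgM; [exact: cvg_cst|exact: cM].
  + by move=> x x0; rewrite normrM e1 mul1r; have [] := IH x x0.
Qed.

Lemma taylor_cis n (a : R) :
  normc (cis a - \sum_(k < n) icoef k * ((2 * pi * a) ^+ k)%:C%C) <=
  2 * (`|2 * pi * a| ^+ n / n`!%:R).
Proof.
rewrite cisE; move: (2 * pi * a) => x.
have [e [e1 xE]] : exists e : R, `|e| = 1 /\ e * `|x| = x.
  have [x0|x0] := leP 0 x; first by exists 1; rewrite normr1 ger0_norm// mul1r.
  by exists (-1); rewrite normrN1 ltr0_norm// mulrNN mul1r.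
have := @taylor_cos_sin n e `|x| e1 (normr_ge0 x); rewrite xE => -[h1 h2].
apply: le_trans (normc_le _) _; rewrite mulr_natl mulr2n.
have RS : Re (\sum_(k < n) icoef k * (x ^+ k)%:C%C) = \sum_(k < n) Re (icoef k) * x ^+ k.
  rewrite (big_morph (@Re R) (@ReD R) erefl).
  by apply: eq_bigr => k _; rewrite ReM/= mulr0 subr0.
have IS : Im (\sum_(k < n) icoef k * (x ^+ k)%:C%C) = \sum_(k < n) Im (icoef k) * x ^+ k.
  rewrite (big_morph (@Im R) (@ImD R) erefl).
  by apply: eq_bigr => k _; rewrite ImM/= mulr0 add0r.
by apply: lerD; rewrite ?ReD ?ReN ?ImD ?ImN ?RS ?IS.
Qed.

(** Analyticity in quantitative form: every Taylor remainder at 0 is controlled on the whole line,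
    with exponential type [D]. *)
Definition taylor_bound (v : R -> R[i]) (p : nat -> R[i]) (A D : R) := forall n x,
  normc (v x - \sum_(k < n) p k * (x ^+ k)%:C%C) <= A * ((D * `|x|) ^+ n / n`!%:R).

(** The bound is a multiple of the general term of an exponential series, which tends to 0. *)
Lemma taylor_bound_eq0 v p A D : taylor_bound v p A D -> (forall k, p k = 0) ->
  forall x, v x = 0.
Proof.
move=> vp p0 x; apply: ComplexField.Normc.eq0_normc; apply/eqP.
rewrite eq_le normc_ge0 andbT.
have c0 : (A * ((D * `|x|) ^+ n / n`!%:R)) @[n --> \oo] --> (0 : R).
  rewrite -(mulr0 A); apply: cvgM; first exact: cvg_cst.
  exact: (cvg_series_cvg_0 (is_cvg_series_exp_coeff (D * `|x|))).
apply: (ler_cvg_to (cvg_cst (normc (v x))) c0); apply: nearW => n.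
have := vp n x; rewrite big1 ?subr0// => k _.
by rewrite p0 mul0r.
Qed.

(** Close to 0, the first nonzero Taylor term dominates the remainder of the next order. *)
Lemma taylor_bound_neq0 v p A D : taylor_bound v p A D -> (exists k, p k != 0) ->
  exists2 d : R, 0 < d & forall x, 0 < x < d -> v x != 0.
Proof.
move=> vp pk; have [m pm mmin] := ex_minnP pk.
pose c := normc (p m); pose C := `|A * (D ^+ m.+1 / m.+1`!%:R)| + 1.
have c0 : 0 < c.
  rewrite lt_neqAle normc_ge0 andbT eq_sym; apply: contra pm => /eqP pm.
  by rewrite (ComplexField.Normc.eq0_normc pm).
have C0 : 0 < C by rewrite ltr_wpDl.
(* A zero [x > 0] of [v] forces [c * x ^+ m <= C * x ^+ m.+1], that is [c / C <= x]. The [+ 1] in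
   [C] keeps it positive. *)
exists (c / C); first by rewrite divr_gt0.
move=> x /andP[x0 xd]; apply/eqP => vx.
have := vp m.+1 x; rewrite vx sub0r normcN big_ord_recr/= big1 ?add0r; last first.
  move=> k _; have := ltn_ord k; rewrite ltnNge; apply: contraNeq => pk0.
  by apply: mmin; apply: contra pk0 => /eqP ->; rewrite mul0r.
rewrite ComplexField.Normc.normcM normcR -/c (gtr0_norm x0) (gtr0_norm (exprn_gt0 m x0)).
rewrite exprMn => H.
have : c * x ^+ m <= C * x * x ^+ m.
  apply: (le_trans H); rewrite -mulrA -exprS.
  rewrite [leLHS](_ : _ = A * (D ^+ m.+1 / m.+1`!%:R) * x ^+ m.+1); last first.
    by rewrite -!mulrA; congr (_ * (_ * _)); rewrite mulrC.
  rewrite ler_wpM2r ?exprn_ge0 ?ltW//.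
  by rewrite (le_lt_trans (ler_norm _))// ltrDl.
rewrite ler_pM2r ?exprn_gt0//.
by rewrite leNgt -ltr_pdivlMl// mulrC xd.
Qed.

Lemma taylor_bound_ft (K : R -> R[i]) (B : R) : 0 < B -> L1 K ->
  (forall t, B < `|t| -> K t = 0) ->
  exists p A D, taylor_bound (ft K) p A D.
Proof.
move=> B0 LK K0.
exists (fun k => cint setT (fun t => K t * (icoef k * ((2 * pi * t) ^+ k)%:C%C))).
(* The coefficients are moments of [K]. The 4 combines the factors 2 of [taylor_cis] and
   [normc_cint_le], and the type comes from [|t| <= B]. *)
exists (4 * \int[mu]_t normc (K t)), (2 * pi * B) => n x.
have pB0 : 0 <= 2 * pi * B by rewrite !mulr_ge0 ?pi_ge0// ltW.
have tyB (k : nat) (t y : R) : `|t| <= B -> `|2 * pi * (t * y)| ^+ k <= (2 * pi * B * `|y|) ^+ k.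
  move=> tB; apply: lerXn2r; rewrite ?nnegrE ?normr_ge0 ?mulr_ge0 ?pi_ge0 ?(ltW B0)//.
  rewrite mulrA !normrM (ger0_norm (pi_ge0 R)) ger0_norm// ler_wpM2r// ler_wpM2l//.
  by rewrite mulr_ge0// pi_ge0.
have LKk (k : nat) (y : R) : L1 (fun t => K t * (icoef k * ((2 * pi * (t * y)) ^+ k)%:C%C)).
  apply: (L1_le _ (rintZ (normc (icoef k) * ((2 * pi * B) * `|y|) ^+ k) (L1_normc LK))).
    apply: cmfM; first exact: L1_cmf.
    apply: cmfM; first exact: cmf_cst.
    apply: cmf_real; apply: measurable_funX; apply: measurable_funM => //.
    exact: measurable_funM.
  move=> t; rewrite !ComplexField.Normc.normcM [leRHS]mulrC.
  have [tB|tB] := ltP B `|t|; first by rewrite K0// ComplexField.Normc.normc0 !mul0r.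
  rewrite ler_wpM2l ?normc_ge0// ler_wpM2l ?normc_ge0// normcR normrX.
  exact: tyB.
have sumE : \sum_(k < n) cint setT (fun t => K t * (icoef k * ((2 * pi * t) ^+ k)%:C%C)) * (x ^+ k)%:C%C
    = cint setT (fun t => K t * \sum_(k < n) icoef k * ((2 * pi * (t * x)) ^+ k)%:C%C) /\
   L1 (fun t => K t * \sum_(k < n) icoef k * ((2 * pi * (t * x)) ^+ k)%:C%C).
  elim: n => [|n [IH1 IH2]].
    rewrite big_ord0; under eq_fun do rewrite big_ord0 mulr0.
    split; first by rewrite /cint /Rintegral /= integral0.
    have := L1Z 0 LK; by under eq_fun do rewrite mul0r.
  rewrite big_ord_recr/= IH1; under [in RHS]eq_fun do rewrite big_ord_recr/= mulrDr.
  under [in X in _ /\ X]eq_fun do rewrite big_ord_recr/= mulrDr.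
  split; last exact: L1D.
  rewrite cintD//; congr (_ + _).
  rewrite mulrC -cintZ; last first.
    have := LKk n 1; by under eq_fun do rewrite mulr1.
  apply: eq_cint => t _; rewrite mulrCA; congr (_ * _); rewrite mulrCA; congr (_ * _).
  by rewrite -rmorphM/= -exprMn; congr ((_ ^+ _)%:C%C); ring.
have [-> LS] := sumE.
rewrite -cintB//; last exact: L1_cis.
have iK := rintZ (2 * ((2 * pi * B * `|x|) ^+ n / n`!%:R)) (L1_normc LK).
apply: (le_trans (normc_cint_le _ iK _)).
- by apply: L1B => //; exact: L1_cis.
- move=> t; rewrite -mulrBr ComplexField.Normc.normcM [leRHS]mulrC.
  have [tB|tB] := ltP B `|t|; first by rewrite K0// ComplexField.Normc.normc0 !mul0r.
  rewrite ler_wpM2l ?normc_ge0//; apply: le_trans (taylor_cis n _) _.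
  rewrite ler_wpM2l// ler_wpM2r ?invr_ge0//.
  exact: tyB.
rewrite RintegralZl//; last exact: L1_normc.
by rewrite le_eqVlt; apply/orP; left; apply/eqP; ring.
Qed.

Lemma ft_mul_eq0 (K L : R -> R[i]) (B : R) : 0 < B -> L1 K -> L1 L ->
  (forall t, B < `|t| -> K t = 0) -> (forall t, B < `|t| -> L t = 0) ->
  (forall x, ft K x * ft L x = 0) -> (forall x, ft K x = 0) \/ (forall x, ft L x = 0).
Proof.
move=> B0 LK LL K0 L0 KL.
have [p [A [D KT]]] := taylor_bound_ft B0 LK K0.
have [q [A' [D' LT]]] := taylor_bound_ft B0 LL L0.
have [pk|pk] := pselect (exists k, p k != 0); last first.
  left; apply: (taylor_bound_eq0 KT) => k; apply/eqP; apply: contrapT => /negP pk0.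
  by apply: pk; exists k.
have [qk|qk] := pselect (exists k, q k != 0); last first.
  right; apply: (taylor_bound_eq0 LT) => k; apply/eqP; apply: contrapT => /negP qk0.
  by apply: qk; exists k.
have [d d0 Kd] := taylor_bound_neq0 KT pk; have [d' d0' Ld] := taylor_bound_neq0 LT qk.
pose x := Num.min d d' / 2.
have m0 : 0 < Num.min d d' by rewrite lt_min d0.
have x0 : 0 < x by rewrite divr_gt0.
have xm : x < Num.min d d' by rewrite /x; lra.
have := KL x; move/eqP; rewrite mulf_eq0 => /orP[] /eqP E.
- by have := Kd x; rewrite x0 (lt_le_trans xm) ?ge_min ?lexx// E eqxx => /(_ isT).
- by have := Ld x; rewrite x0 (lt_le_trans xm) ?ge_min ?lexx ?orbT// E eqxx => /(_ isT).
Qed.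

End analytic.

(** * Paley-Wiener functions and the window *)

Section paley_wiener.
Variable R : realType.
Local Notation mu := (@lebesgue_measure R).

Lemma cint_ae_eq (f g : R -> R[i]) : cmf f -> cmf g -> {ae mu, forall x : R, f x = g x} ->
  cint setT f = cint setT g.
Proof.
move=> [f1 f2] [g1 g2] fg; apply: complex_ext => /=; congr fine;
  (apply: ae_eq_integral => //; [exact/measurable_EFinP..|]);
  by apply: aeS fg => x fgx _ /=; rewrite fgx.
Qed.

(** [PW2] constrains [F] only on [[- B, B]]; extension by zero gives a function on the line, to
    which [ft] applies. *)
Definition cutoff (B : R) (F : R -> R[i]) (t : R) : R[i] := if t \in `[- B, B] then F t else 0.

Lemma cutoff_supp B F t : B < `|t| -> cutoff B F t = 0.
Proof. by rewrite /cutoff in_itv/= -ler_norml ltNge => /negbTE ->. Qed.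

Lemma cutoffE (P : R[i] -> R) B F : P 0 = 0 ->
  (fun t => P (cutoff B F t)) = (fun t => P (F t)) \_ `[- B, B].
Proof.
move=> P0; apply/funext => t; rewrite /cutoff patchE.
have -> : (t \in `[- B, B]%classic) = (t \in `[- B, B]) by rewrite mem_setE.
by case: ifP => _; rewrite ?P0.
Qed.

Lemma L2_cutoff B F : L2on `[- B, B] F -> L2 (cutoff B F).
Proof.
move=> [F1 [F2 F3]]; split; [|split].
- by rewrite (cutoffE (P := @Re R))//; apply/(measurable_restrictT _ _).1 => //.
- by rewrite (cutoffE (P := @Im R))//; apply/(measurable_restrictT _ _).1 => //.
suff : rint (fun x => normc (cutoff B F x) ^+ 2) by [].
have n0 : normc (0 : R[i]) ^+ 2 = 0 by rewrite ComplexField.Normc.normc0 expr0n.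
have -> : (fun x => normc (cutoff B F x) ^+ 2) = (fun x => normc (F x) ^+ 2) \_ `[- B, B].
  exact: (cutoffE (P := fun z => normc z ^+ 2)).
by rewrite /rint -restrict_EFin; apply/integrable_restrict => //; rewrite setTI.
Qed.

(** On a bounded interval [|F| <= 1 + |F|^2] is an integrable majorant. *)
Lemma L1_cutoff B F : L2on `[- B, B] F -> L1 (cutoff B F).
Proof.
move=> /L2_cutoff [F1 [F2 F3]]; apply: (L1_le (conj F1 F2) (rintD (rint_indic_itv (- B) B) F3)) => t.
rewrite indicE; have -> : (t \in `[- B, B]%classic) = (t \in `[- B, B]) by rewrite mem_setE.
rewrite /cutoff; case: ifP => _ /=; last by rewrite expr0n/= addr0 sqrtr0 expr0n addr0.
by have := sqr_ge0 (normc (F t) - 2^-1); lra.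
Qed.

Lemma cint_cutoff B F (h : R -> R[i]) :
  cint `[- B, B] (fun x => F x * h x) = cint setT (fun x => cutoff B F x * h x).
Proof.
have E (P : R[i] -> R) : P 0 = 0 -> \int[mu]_(x in `[- B, B]) P (F x * h x) =
    \int[mu]_x P (cutoff B F x * h x).
  move=> P0; rewrite Rintegral_mkcond; apply: eq_Rintegral => t _.
  rewrite patchE /cutoff.
  have -> : (t \in `[- B, B]%classic) = (t \in `[- B, B]) by rewrite mem_setE.
  by case: ifP => //; rewrite mul0r.
by congr Complex; [exact: (E (@Re R))|exact: (E (@Im R))].
Qed.

Lemma normc_cexp (w : R[i]) : normc (cexp w) = expR (Re w).
Proof.
rewrite /cexp /= !exprMn -mulrDr cos2Dsin2 mulr1 sqrtr_sqr ger0_norm//.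
Qed.

Lemma cmf_cexp_line (z : R[i]) : cmf (fun x : R => cexp (Complex 0 (2 * pi * x) * z)).
Proof.
have m1 : measurable_fun setT (fun x : R => Re (Complex 0 (2 * pi * x) * z)).
  under eq_fun do rewrite ReM/= mul0r sub0r.
  by apply: measurableT_comp => //; apply: measurable_funM => //; exact: measurable_funM.
have m2 : measurable_fun setT (fun x : R => Im (Complex 0 (2 * pi * x) * z)).
  under eq_fun do rewrite ImM/= mul0r add0r.
  by apply: measurable_funM => //; exact: measurable_funM.
split; apply: measurable_funM; try exact: (measurableT_comp _ m1).
  by apply: (measurableT_comp _ m2); apply: continuous_measurable_fun; exact: continuous_cos.
by apply: (measurableT_comp _ m2); apply: continuous_measurable_fun; exact: continuous_sin.
Qed.

(** The theorem equates functions on the complex plane, so off the real line the exponential has to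
    be bounded on the band. *)
Lemma L1_cutoff_cexp B F (z : R[i]) : L2on `[- B, B] F ->
  L1 (fun x => cutoff B F x * cexp (Complex 0 (2 * pi * x) * z)).
Proof.
move=> LF; have L1F := L1_cutoff LF.
apply: (L1_le _ (rintZ (expR (2 * pi * B * `|Im z|)) (L1_normc L1F))).
  by apply: cmfM; [exact: L1_cmf|exact: cmf_cexp_line].
move=> x; rewrite ComplexField.Normc.normcM mulrC.
have [xB|xB] := ltP B `|x|; first by rewrite cutoff_supp// ComplexField.Normc.normc0 !mulr0.
rewrite ler_wpM2r ?normc_ge0// normc_cexp ler_expR ReM/= mul0r sub0r.
rewrite (le_trans (ler_norm _))// normrN !normrM ler_wpM2r// (ger0_norm (pi_ge0 R)).
by rewrite ger0_norm// ler_wpM2l// mulr_ge0// pi_ge0.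
Qed.

Lemma ft_cutoff B F (t : R) :
  cint `[- B, B] (fun xi => F xi * cexp (Complex 0 (2 * pi * xi) * Complex t 0)) =
  ft (cutoff B F) t.
Proof.
rewrite cint_cutoff; apply: eq_cint => x _; congr (_ * _); rewrite /cis; congr cexp.
by apply: complex_ext; rewrite ?ReM ?ImM /=; ring.
Qed.

Lemma STFT_ft (phi f : R -> R[i]) (x w : R) :
  STFT phi f x w = ft (fun t => f t * conjc (phi (t - x))) (- w).
Proof.
apply: eq_cint => t _; congr (_ * _); rewrite /cis; congr (cexp (Complex _ _)).
by ring.
Qed.

Lemma L2M_bounded (u v : R -> R[i]) (C : R) : L2 u -> cmf v -> (forall x, normc (v x) <= C) ->
  L2 (fun x => v x * u x).
Proof.
move=> [u1 [u2 u3]] mv vC; have mvu := cmfM mv (conj u1 u2); case: (mvu) => m1 m2.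
split; [exact: m1|split; [exact: m2|]].
apply: (rint_le _ (rintZ (C ^+ 2) u3)).
  by apply: measurable_funX; exact: measurable_normc.
move=> x; rewrite ger0_norm ?sqr_ge0// ComplexField.Normc.normcM exprMn.
rewrite ler_wpM2r ?sqr_ge0// lerXn2r ?nnegrE ?normc_ge0//.
exact: le_trans (normc_ge0 (v x)) (vC x).
Qed.

Lemma L1_sqr_normc (phi : R -> R[i]) : L2 phi -> L1 (fun t => (normc (phi t) ^+ 2)%:C%C).
Proof. by move=> [_ [_ p3]]; exact: L1_real. Qed.

(** As [|phi|^2] is real, its transform at [- w] is conjugate to that at [w], so the opposite sign
    conventions do not affect vanishing. *)
Lemma ft_sqr_normc_neq0 (phi : R -> R[i]) (w : R) : L2 phi -> ambig phi 0 w != 0 ->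
  ft (fun t => (normc (phi t) ^+ 2)%:C%C) w != 0.
Proof.
move=> Lp; apply: contra => /eqP E; rewrite /ambig STFT_ft.
have -> : ft (fun t => phi t * conjc (phi (t - 0))) (- w) =
    conjc (ft (fun t => (normc (phi t) ^+ 2)%:C%C) w).
  rewrite -cintJ; last by apply: L1_cis; exact: L1_sqr_normc.
  apply: eq_cint => t _; rewrite subr0 mulcJ conjcM mulrN cisN; congr (_ * _).
  by rewrite conjc_real.
by rewrite E conjc0 mulr0.
Qed.

Section uniqueness.
Variables (B : R) (phi : R -> R[i]) (F G : R -> R[i]).
Hypotheses (B0 : 0 < B) (Lphi : L2 phi).
Hypothesis phi_neq0 : {ae mu, forall w : R, w \in `]- (2 * B), 2 * B[ -> ambig phi 0 w != 0}.
Hypotheses (LF : L2on `[- B, B] F) (LG : L2on `[- B, B] G).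

Let F0 := cutoff B F.
Let G0 := cutoff B G.
Let f := ft F0.
Let g := ft G0.

Hypotheses (fr : forall t, Im (f t) = 0) (gr : forall t, Im (g t) = 0).
Hypothesis fg : forall x w, normc (STFT phi f x w) = normc (STFT phi g x w).

Let q (t : R) := normc (phi t) ^+ 2.

(** The two hypotheses of Plancherel: a product of two square integrable functions, and a bounded
    function times a square integrable one. *)
Lemma L1L2_window (K : R -> R[i]) (x : R) : L2on `[- B, B] K ->
  L1 (fun t => ft (cutoff B K) t * conjc (phi (t - x))) /\
  L2 (fun t => ft (cutoff B K) t * conjc (phi (t - x))).
Proof.
move=> LK; have L1K := L1_cutoff LK; have L2K := L2_cutoff LK.
have Lp : L2 (fun t => conjc (phi (t - x))) by apply: L2_conj; exact: L2_shift.
split.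
  by apply: L2_L1M => //; apply: (L2_ft B0) => // t; exact: cutoff_supp.
apply: (L2M_bounded (C := 2 * \int[mu]_t normc (cutoff B K t)) Lp); first exact: cmf_ft.
by move=> t; exact: normc_ft_le.
Qed.

Lemma spectrogram_window_integral x :
  \int[mu]_t (normc (f t) ^+ 2 * q (t - x)) = \int[mu]_t (normc (g t) ^+ 2 * q (t - x)).
Proof.
have [f1 f2] := L1L2_window x LF; have [g1 g2] := L1L2_window x LG.
have E (k : R -> R[i]) : \int[mu]_t (normc (k t) ^+ 2 * q (t - x)) =
    \int[mu]_t (normc (k t * conjc (phi (t - x))) ^+ 2).
  by apply: eq_Rintegral => t _; rewrite ComplexField.Normc.normcM normc_conjc exprMn.
rewrite !E; apply: (eq_norm_ft f1 f2 g1 g2) => w.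
by have := fg x (- w); rewrite !STFT_ft opprK.
Qed.

Let H t := conv F0 F0 t - conv G0 G0 t.

Let L1F := L1_cutoff LF. Let L1G := L1_cutoff LG.
Let L2F := L2_cutoff LF. Let L2G := L2_cutoff LG.

Let LH : L1 H.
Proof. by apply: L1B; [have [] := conv_ft L1F L2F L1F L2F|have [] := conv_ft L1G L2G L1G L2G]. Qed.

Let ft_H t : ft H t = f t ^+ 2 - g t ^+ 2.
Proof.
have [cF eF] := conv_ft L1F L2F L1F L2F; have [cG eG] := conv_ft L1G L2G L1G L2G.
by rewrite ftB// eF eG.
Qed.

Let sqr_real (z : R[i]) : Im z = 0 -> z ^+ 2 = (normc z ^+ 2)%:C%C.
Proof.
by move=> z0; apply: complex_ext; rewrite expr2 ?ReM ?ImM sqr_normcE z0 /=; ring.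
Qed.

Let ae_H : {ae mu, forall w : R, H w = 0}.
Proof.
have Lq := L1_sqr_normc Lphi.
have Lqs x : L1 (fun t => (q (t - x))%:C%C) by have [] := cint_shift x Lq.
pose hq := ft (fun t => (q t)%:C%C).
have LHq : L1 (fun w => H w * hq w).
  apply: L1M_bounded LH (cmf_ft Lq) _ => w; exact: normc_ft_le.
have /(ft_eq0_ae LHq) Hq0 : forall x, ft (fun w => H w * hq w) x = 0.
  (* Shifting the window by [x] multiplies its transform by a character, so [ft_mult] reads the
     transform of [H * hq] at [x] as an integral against the shifted window. *)
  move=> x; transitivity (cint setT (fun t => ft H t * (q (t - x))%:C%C)).
    rewrite (ft_mult LH (Lqs x)); apply: eq_cint => w _.
    by rewrite (ft_shift _ _ Lq) -mulrA; congr (_ * _); rewrite mulrC (mulrC w).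
  (* Real values on the line enter here, to replace squares by squared moduli. *)
  rewrite (_ : (fun t => _) = fun t => (normc (f t) ^+ 2 * q (t - x) -
      normc (g t) ^+ 2 * q (t - x))%:C%C); last first.
    by apply/funext => t; rewrite ft_H !sqr_real//;
      move: (normc (f t) ^+ 2) (normc (g t) ^+ 2) (q _) => a b c;
      apply: complex_ext; rewrite !ReImE /=; ring.
  have rK (K : R -> R[i]) : L2on `[- B, B] K ->
      rint (fun t => normc (ft (cutoff B K) t) ^+ 2 * q (t - x)).
    move=> LK; have [_ [_ [_ i3]]] := L1L2_window x LK.
    by move: i3; under eq_fun do rewrite ComplexField.Normc.normcM normc_conjc exprMn.
  rewrite cint_real RintegralB//; [|exact: rK..].
  by rewrite spectrogram_window_integral subrr.
(* The points [2 * B] and [- (2 * B)] are covered neither by the support condition nor by the open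
   interval, and are discarded as a null set. *)
apply: aeS (aeI (aeI Hq0 phi_neq0) (ae_neq2 (- (2 * B)) (2 * B))) => w [[Hw phiw] [w1 w2]].
have [wB|wB] := ltP (2 * B) `|w|.
  rewrite /H (@conv_supp _ F0 F0 B)//; try by move=> t; exact: cutoff_supp.
  by rewrite (@conv_supp _ G0 G0 B) ?subrr// => t; exact: cutoff_supp.
have wI : w \in `]- (2 * B), 2 * B[.
  move: wB; rewrite in_itv/= ler_norml => /andP[h1 h2].
  by rewrite !lt_neqAle h1 h2 w2 eq_sym w1.
move/eqP: Hw; rewrite mulf_eq0 => /orP[/eqP//|/eqP E].
by have := ft_sqr_normc_neq0 Lphi (phiw wI); rewrite -/hq E eqxx.
Qed.

Lemma ae_eq_or_opp : {ae mu, forall w : R, F0 w = G0 w} \/ {ae mu, forall w : R, F0 w = - G0 w}.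
Proof.
(* [H] vanishes only almost everywhere, but its transform then vanishes at every point. *)
have fg2 x : f x ^+ 2 - g x ^+ 2 = 0.
  rewrite -ft_H (_ : 0 = ft (fun=> 0) x); last first.
    rewrite /ft; under eq_fun do rewrite mul0r.
    by rewrite /cint /Rintegral /= integral0.
  apply: cint_ae_eq.
  - exact: L1_cmf (L1_cis x LH).
  - by apply: cmfM; [exact: cmf_cst|apply: cmf_cis; exact: measurable_funM].
  - by apply: aeS ae_H => w ->.
have LD := L1D L1F L1G; have LB := L1B L1F L1G.
have ftD x : ft (fun w => F0 w + G0 w) x = f x + g x.
  rewrite -cintD; [|exact: L1_cis..].
  by apply: eq_cint => t _; rewrite mulrDl.
have [||x|E|E] := ft_mul_eq0 B0 LB LD.
- by move=> t tB; rewrite !cutoff_supp ?subrr.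
- by move=> t tB; rewrite !cutoff_supp ?addr0.
- by rewrite ftB// ftD -subr_sqr.
- by left; apply: aeS (ft_eq0_ae LB E) => w /eqP; rewrite subr_eq0 => /eqP.
- by right; apply: aeS (ft_eq0_ae LD E) => w /eqP; rewrite addr_eq0 => /eqP.
Qed.

End uniqueness.

End paley_wiener.

Unset Implicit Arguments.

Theorem theorem2p2 (R : realType) (B : R) (phi : R -> R[i]) :
  0 < B -> L2 phi ->
  {ae @lebesgue_measure R, forall w : R,
      w \in `]- (2 * B), 2 * B[ -> ambig phi 0 w != 0} ->
  forall f g : R[i] -> R[i], PW2 B f -> PW2 B g ->
    (forall t : R, complex.Im (f (Complex t 0)) = 0) ->
    (forall t : R, complex.Im (g (Complex t 0)) = 0) ->
    ((f = g \/ f = (fun z => - g z)) <->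
     (forall x w : R,
        ComplexField.Normc.normc (STFT phi (restrR f) x w) = ComplexField.Normc.normc (STFT phi (restrR g) x w))).
Proof.
move=> B0 Lphi phi_neq0 f g [F [LF fE]] [G [LG gE]] fr gr.
have rf : restrR f = ft (cutoff B F) by apply/funext => t; rewrite /restrR fE ft_cutoff.
have rg : restrR g = ft (cutoff B G) by apply/funext => t; rewrite /restrR gE ft_cutoff.
split=> [[->//|fg] x w|].
  have -> : restrR f = fun t => - restrR g t by rewrite fg.
  rewrite rg -[RHS]normcN !STFT_ft; congr normc.
  rewrite -cintN; last by apply: L1_cis; exact: (L1L2_window B0 Lphi x LG).1.
  by apply: eq_cint => t _; rewrite !mulNr.
rewrite rf rg => fg.
have fr' t : Im (ft (cutoff B F) t) = 0 by rewrite -rf; exact: fr.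
have gr' t : Im (ft (cutoff B G) t) = 0 by rewrite -rg; exact: gr.
(* An almost everywhere relation between the spectra determines the defining integrals at every
   complex [z]. *)
have [E|E] := ae_eq_or_opp B0 Lphi phi_neq0 LF LG fr' gr' fg; [left|right];
  apply/funext => z; rewrite fE gE !cint_cutoff.
- apply: cint_ae_eq; [exact: L1_cmf (L1_cutoff_cexp z LF)|exact: L1_cmf (L1_cutoff_cexp z LG)|].
  by apply: aeS E => w ->.
- rewrite -cintN; last exact: L1_cutoff_cexp.
  apply: cint_ae_eq; [exact: L1_cmf (L1_cutoff_cexp z LF)|exact: L1_cmf (L1N (L1_cutoff_cexp z LG))|].
  by apply: aeS E => w ->; rewrite mulNr.
Qed.
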